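(* For every $n\in\mathbb{N}=\{0,1,2,\dots\}$ and every $a\in\mathbb{D}$ one has $\mathrm{M_F}(k_{n,a})=\mathrm{M_F}(e_{n,a})=n$. Moreover, for every $n\ge 1$ and every $n$-tuple $(a_1,\dots,a_n)$ of points of $\mathbb{D}$ (repetitions allowed), the $n$-th Takenaka–Malmquist function $$B_n(z)=\frac{\sqrt{1-|a_n|^2}}{1-\overline{a_n}z}\prod_{l=1}^{n-1}\frac{z-a_l}{1-\overline{a_l}z}$$ satisfies $\mathrm{M_F}(B_n)=n-1$.
   Context: $\mathbb{D}$ is the open unit disc and $H^2(\mathbb{D})$ the Hardy space of the disc. For $a\in\mathbb{D}$, $k_a(z)=\frac{1}{1-\overline{a}z}$ is the Szegő kernel; the multiple Szegő kernels are $k_{n,a}(z)=\left(\frac{\partial}{\partial\overline{a}}\right)^n k_a(z)=\frac{n!\,z^n}{(1-\overline{a}z)^{n+1}}$, and $e_{n,a}=k_{n,a}/\|k_{n,a}\|_{H^2}$. Mean-frequency: every $f\in H^2(\mathbb{D})$, $f\not\equiv 0$, factors (uniquely up to unimodular constants) as $f=\phi\, s\, o$ with $\phi$ a Blaschke product, $s$ a singular inner function and $o$ an outer function; on the boundary, a.e., $\phi(e^{it})=e^{i\theta_\phi(t)}$ and $s(e^{it})=e^{i\theta_s(t)}$ with real phase functions $\theta_\phi,\theta_s$. The mean-frequency of $f$ is $\mathrm{M_F}(f)=\frac{1}{2\pi}\left(\int_0^{2\pi}\theta_\phi'(t)\,dt+\int_0^{2\pi}\theta_s'(t)\,dt\right)$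 (so that, e.g., $\mathrm{M_F}(z^n)=n$ and the mean-frequency of a Möbius factor $\frac{z-a}{1-\overline{a}z}$ equals $1$, and outer functions have mean-frequency $0$). *)

(* Defs.v *)
From HB Require Import structures.
From mathcomp Require Import all_boot all_order all_algebra.
From mathcomp Require Import complex.
From mathcomp Require Import all_classical all_reals all_analysis.

Set Implicit Arguments.
Unset Strict Implicit.
Unset Printing Implicit Defensive.

Import Order.TTheory GRing.Theory Num.Theory.
Import numFieldNormedType.Exports.

Local Open Scope classical_set_scope.
Local Open Scope ring_scope.
Local Open Scope complex_scope.

Notation normc := (@ComplexField.Normc.normc _).

Section HardyDefs.
Variable R : realType.

Definition cexp (z : R[i]) : R[i] :=
  (expR (complex.Re z))%:C * (cos (complex.Im z) +i* sin (complex.Im z)).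
Definition expi (t : R) : R[i] := cos t +i* sin t.

Definition in_disc (z : R[i]) : Prop := normc z < 1.

Definition ccvg (u : nat -> R[i]) (w : R[i]) : Prop :=
  (fun k => normc (u k - w)) @ \oo --> (0 : R).

Definition in_H2 (f : R[i] -> R[i]) : Prop :=
  exists c : nat -> R[i],
    cvg (series (fun k => normc (c k) ^+ 2) @ \oo) /\
    forall z, in_disc z -> ccvg (fun N => \sum_(k < N) c k * z ^+ k) (f z).

Definition H2_norm (f : R[i] -> R[i]) : R :=
  Num.sqrt (sup [set ((2 * pi)%R)^-1 *
     fine (\int[lebesgue_measure]_(t in `[0%R, (2 * pi)%R]%classic)
             (normc (f (r%:C * expi t)) ^+ 2)%:E)
     | r in `[0%R, 1[%classic]).

Definition herglotz_kernel (t : R) (z : R[i]) : R[i] :=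
  (expi t + z) / (expi t - z).

Definition herglotz (mu : {measure set (measurableTypeR R) -> \bar R}) (k : R -> R) (z : R[i])
  : R[i] :=
  fine (\int[mu]_(t in `[0%R, (2 * pi)%R[%classic) (complex.Re (herglotz_kernel t z) * k t)%:E)
  +i*
  fine (\int[mu]_(t in `[0%R, (2 * pi)%R[%classic) (complex.Im (herglotz_kernel t z) * k t)%:E).

(** Blaschke products (possibly infinite; a zero sequence entry None means
    "no factor"), with a unimodular constant and a zero of order m at 0 *)
Definition blaschke_factor (a z : R[i]) : R[i] :=
  ((normc a)%:C / a) * ((a - z) / (1 - a^* * z)).

Definition is_Blaschke (B : R[i] -> R[i]) : Prop :=
  exists (c : R[i]) (m : nat) (a : nat -> option R[i]),
    normc c = 1 /\
    (forall k w, a k = Some w -> w != 0 /\ in_disc w) /\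
    cvg (series (fun k => match a k with Some w => 1 - normc w | None => 0 end)
          @ \oo) /\
    forall z, in_disc z ->
      ccvg (fun N => c * z ^+ m *
                     \prod_(k < N) match a k with
                                   | Some w => blaschke_factor w z
                                   | None => 1 end) (B z).

Definition is_singular_inner (s : R[i] -> R[i]) : Prop :=
  exists (c : R[i]) (mu : {measure set (measurableTypeR R) -> \bar R}),
    normc c = 1 /\
    mu (~` `[0%R, (2 * pi)%R[%classic) = 0%E /\
    (mu `[0%R, (2 * pi)%R[%classic < +oo)%E /\
    (exists A : set (measurableTypeR R), measurable A /\ lebesgue_measure A = 0%E /\
                      mu (~` A) = 0%E) /\
    forall z, in_disc z -> s z = c * cexp (- herglotz mu (fun=> 1) z).

Definition is_outer (o : R[i] -> R[i]) : Prop :=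
  exists (c : R[i]) (k : R -> R),
    normc c = 1 /\
    lebesgue_measure.-integrable `[0%R, (2 * pi)%R]%classic (EFin \o k) /\
    forall z, in_disc z ->
      o z = c * cexp ((((2 * pi)%R)^-1)%:C * herglotz lebesgue_measure k z).

Definition inner_outer_factorization (f phi s o : R[i] -> R[i]) : Prop :=
  is_Blaschke phi /\ is_singular_inner s /\ is_outer o /\
  forall z, in_disc z -> f z = phi z * s z * o z.

Definition radial_limit (g : R[i] -> R[i]) (t : R) (w : R[i]) : Prop :=
  normc (g (r%:C * expi t) - w) @[r --> 1^'-] --> (0 : R).

Definition is_phase (g : R[i] -> R[i]) (theta : R -> R) : Prop :=
  {ae lebesgue_measure, forall t, 0 < t < (2 * pi)%R ->
       radial_limit g t (expi (theta t))} /\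
  {ae lebesgue_measure, forall t, 0 < t < (2 * pi)%R -> derivable theta t 1} /\
  lebesgue_measure.-integrable `[0%R, (2 * pi)%R]%classic (EFin \o derive1 theta).

Definition mf_value (theta_phi theta_s : R -> R) : R :=
  ((2 * pi)%R)^-1 *
  (fine (\int[lebesgue_measure]_(t in `[0%R, (2 * pi)%R]%classic) (derive1 theta_phi t)%:E)
 + fine (\int[lebesgue_measure]_(t in `[0%R, (2 * pi)%R]%classic) (derive1 theta_s t)%:E)).

Definition mean_frequency_is (f : R[i] -> R[i]) (v : R) : Prop :=
  in_H2 f /\ (exists z, in_disc z /\ f z != 0) /\
  (exists phi s o th_phi th_s, inner_outer_factorization f phi s o /\
       is_phase phi th_phi /\ is_phase s th_s) /\
  (forall phi s o th_phi th_s, inner_outer_factorization f phi s o ->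
       is_phase phi th_phi -> is_phase s th_s -> mf_value th_phi th_s = v).

Definition szego_kernel (n : nat) (a : R[i]) (z : R[i]) : R[i] :=
  (n`!)%:R * z ^+ n / (1 - a^* * z) ^+ n.+1.

Definition normalized_szego_kernel (n : nat) (a : R[i]) (z : R[i]) : R[i] :=
  szego_kernel n a z / (H2_norm (szego_kernel n a))%:C.

Definition TM (n : nat) (a : nat -> R[i]) (z : R[i]) : R[i] :=
  (Num.sqrt (1 - normc (a n) ^+ 2))%:C / (1 - (a n)^* * z) *
  \prod_(1 <= l < n) ((z - a l) / (1 - (a l)^* * z)).

End HardyDefs.

(* Main.v *)
(** Each of these functions is a product [f = B * g] of a finite Blaschke product [B] and an
    outer function [g], and the mean-frequency of such an [f] is the number of zeros of [B].

    The outer factors are built from the functions [1 - b * z].  Such a function is outer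
    because the Herglotz integral of [ln |1 - b * e^(it)|] is [2 pi * log (1 - b * z)]; this is
    obtained by replacing [b] with [x * b] and differentiating in [x].

    Let [f = phi * s * o] be any factorization.  The zeros of [f] are finite in number, so
    [phi] is a finite Blaschke product; as [s], [o] and [g] are bounded above and below on
    compact subsets of the disc, [phi] has the zeros of [B] with multiplicity.  Near the unit
    circle [|s| = |g / o|], so the Poisson integral of the singular measure of [s] is there
    the Poisson integral of an integrable function [h].  It tends to [0] radially almost
    everywhere because the radial limits of [s] are unimodular, and it is uniformly
    integrable because [h] is integrable; hence the measure has mass [0] and [s] is constant.
    Finally two phases of the same boundary function differ almost everywhere by a multiple
    of [2 pi], so they have the same derivative almost everywhere. *)

Require Import Defs.
From HB Require Import structures.
From mathcomp Require Import all_boot all_order all_algebra.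
From mathcomp Require Import complex.
From mathcomp Require Import all_classical all_reals all_analysis.
From mathcomp Require Import measurable_realfun.
From mathcomp Require Import ring lra.

Set Implicit Arguments.
Unset Strict Implicit.
Unset Printing Implicit Defensive.

Import Order.TTheory GRing.Theory Num.Theory.
Import numFieldNormedType.Exports.
Import ComplexField.Normc.

Local Open Scope classical_set_scope.
Local Open Scope complex_scope.
Local Open Scope ring_scope.

Local Notation Re := complex.Re.
Local Notation Im := complex.Im.
Local Notation I02pi := (`[0%R, (2 * pi)%R]%classic).
Local Notation J02pi := (`[0%R, (2 * pi)%R[%classic).

(** * Complex modulus, limits and derivatives *)

Section ComplexModulus.
Variable R : realType.
Implicit Types (z w : R[i]) (t x y : R).

Lemma normc_ge0 z : 0 <= normc z.
Proof. by case: z => a b; rewrite /= sqrtr_ge0. Qed.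

Lemma normc_sqr z : normc z ^+ 2 = Re z ^+ 2 + Im z ^+ 2.
Proof. by case: z => a b /=; rewrite sqr_sqrtr// addr_ge0 ?sqr_ge0. Qed.

Lemma normc_eq0 z : (normc z == 0) = (z == 0).
Proof. by apply/eqP/eqP => [|->]; [exact: eq0_normc|exact: normc0]. Qed.

Lemma normc_gt0 z : (0 < normc z) = (z != 0).
Proof. by rewrite lt_def normc_ge0 andbT normc_eq0. Qed.

Lemma normcX z n : normc (z ^+ n) = normc z ^+ n.
Proof. by elim: n => [|n IH]; rewrite ?expr0 ?normc1// !exprS normcM IH. Qed.

Lemma normc_conj z : normc z^* = normc z.
Proof. by case: z => a b /=; rewrite sqrrN. Qed.

Lemma le_normcB z w : normc (z - w) <= normc z + normc w.
Proof. by rewrite -(normcN w); exact: le_normcD. Qed.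

Lemma le_normc_dist z w : normc z - normc w <= normc (z - w).
Proof. by rewrite lerBlDr -{1}(subrK w z); exact: le_normcD. Qed.

Lemma normcR x : normc (x%:C) = `|x|.
Proof. by rewrite /= expr0n/= addr0 sqrtr_sqr. Qed.

Lemma le_Re_normc z : `|Re z| <= normc z.
Proof. by case: z => a b /=; rewrite -sqrtr_sqr ler_wsqrtr// lerDl sqr_ge0. Qed.

Lemma le_Im_normc z : `|Im z| <= normc z.
Proof. by case: z => a b /=; rewrite -sqrtr_sqr ler_wsqrtr// lerDr sqr_ge0. Qed.

Lemma le_normc_ReIm z : normc z <= `|Re z| + `|Im z|.
Proof.
rewrite {1}[z]complexE; apply: (le_trans (le_normcD _ _)).
rewrite normcM !normcR lerD2l.
by rewrite (_ : normc 'i%C = 1) ?mul1r//= expr0n/= expr1n add0r sqrtr1.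
Qed.

Lemma mulcJ z : z * z^* = (normc z ^+ 2)%:C.
Proof. by rewrite normc_sqr; case: z => a b; simpc; congr (_ +i* _); ring. Qed.

Lemma ReD z w : Re (z + w) = Re z + Re w. Proof. by case: z; case: w. Qed.
Lemma ImD z w : Im (z + w) = Im z + Im w. Proof. by case: z; case: w. Qed.
Lemma ReN z : Re (- z) = - Re z. Proof. by case: z. Qed.
Lemma ImN z : Im (- z) = - Im z. Proof. by case: z. Qed.
Lemma ReM z w : Re (z * w) = Re z * Re w - Im z * Im w.
Proof. by case: z; case: w. Qed.
Lemma ImM z w : Im (z * w) = Re z * Im w + Im z * Re w.
Proof. by case: z; case: w. Qed.
Lemma ReZ x z : Re (x%:C * z) = x * Re z.
Proof. by rewrite ReM/= mul0r subr0. Qed.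
Lemma ImZ x z : Im (x%:C * z) = x * Im z.
Proof. by rewrite ImM/= mul0r addr0. Qed.
Lemma ReJ z : Re z^* = Re z. Proof. by case: z. Qed.
Lemma ImJ z : Im z^* = - Im z. Proof. by case: z. Qed.
Lemma ReV z : Re z^-1 = Re z / (Re z ^+ 2 + Im z ^+ 2).
Proof. by case: z. Qed.
Lemma ImV z : Im z^-1 = - (Im z / (Re z ^+ 2 + Im z ^+ 2)).
Proof. by case: z. Qed.

Lemma complex_ext z w : Re z = Re w -> Im z = Im w -> z = w.
Proof. by case: z => a b; case: w => c d /= -> ->. Qed.

Lemma imaginary_unit_neq0 : 'i%C != 0 :> R[i].
Proof. by rewrite eq_complex/= oner_eq0 andbF. Qed.

Lemma Re_1sub_gt0 w : normc w < 1 -> 0 < Re (1 - w).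
Proof.
move=> w1; rewrite ReD ReN/= subr_gt0 (le_lt_trans _ w1)//.
by rewrite (le_trans _ (le_Re_normc w))// ler_norm.
Qed.

Lemma sub1_neq0 w : normc w < 1 -> 1 - w != 0.
Proof. by move=> /Re_1sub_gt0; apply: contraTneq => ->; rewrite ltxx. Qed.

Lemma normcM_lt1 z w : normc z < 1 -> normc w <= 1 -> normc (z * w) < 1.
Proof. by move=> z1 w1; rewrite normcM (le_lt_trans _ z1)// ler_piMr ?normc_ge0. Qed.

Lemma normc_1sub_ge b z : normc z <= 1 -> 1 - normc b <= normc (1 - b * z).
Proof.
move=> z1; apply: le_trans (le_normc_dist _ _); rewrite normc1 lerD2l lerN2 normcM.
by rewrite ler_piMr ?normc_ge0.
Qed.

Lemma normc_1sub_le b z : normc b <= 1 -> normc z <= 1 -> normc (1 - b * z) <= 2.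
Proof.
move=> b1 z1; apply: (le_trans (le_normcB _ _)).
by rewrite normc1 normcM -[2]/(1 + 1) lerD2l mulr_ile1 ?normc_ge0.
Qed.

End ComplexModulus.

Section ComplexExponential.
Variable R : realType.
Implicit Types (z w : R[i]) (t x y : R).

Lemma normc_expi t : normc (expi t) = 1.
Proof. by rewrite /expi /= cos2Dsin2 sqrtr1. Qed.

Lemma expi_neq0 t : expi t != 0.
Proof. by rewrite -normc_gt0 normc_expi. Qed.

Lemma expi0 : expi (0 : R) = 1.
Proof. by rewrite /expi cos0 sin0. Qed.

Lemma expi2pi : expi (2 * pi) = 1 :> R[i].
Proof. by rewrite /expi mulr_natl cos2pi sin2pi. Qed.

Lemma expiD x y : expi (x + y) = expi x * expi y.
Proof. by apply: complex_ext; rewrite ?ReM ?ImM /= ?cosD ?sinD // addrC. Qed.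

Lemma expiN t : expi (- t) = (expi t)^*.
Proof. by rewrite /expi cosN sinN. Qed.

Lemma conj_expi t : (expi t)^* = (expi t)^-1.
Proof.
apply: (mulfI (expi_neq0 t)).
by rewrite mulcJ normc_expi expr1n divff ?expi_neq0.
Qed.

Lemma normcM_expi z t : normc (z * expi t) = normc z.
Proof. by rewrite normcM normc_expi mulr1. Qed.

Lemma expi_sub_neq0 z t : normc z < 1 -> expi t - z != 0.
Proof.
by rewrite subr_eq0 => z1; apply: contraTneq z1 => <-; rewrite normc_expi ltxx.
Qed.

Lemma sub1_expi_neq0 z t : normc z < 1 -> 1 - z * expi t != 0.
Proof. by move=> z1; apply: sub1_neq0; rewrite normcM_expi. Qed.

Lemma in_disc_polar x t : 0 <= x < 1 -> in_disc (x%:C * expi t).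
Proof. by move=> /andP[x0 x1]; rewrite /in_disc normcM_expi normcR ger0_norm. Qed.

Lemma unimodular_expi z : normc z = 1 -> exists t, z = expi t.
Proof.
case: z => a b z1; have ab : a ^+ 2 + b ^+ 2 = 1.
  by have := normc_sqr (a +i* b); rewrite z1 expr1n.
have a1 : -1 <= a <= 1.
  by rewrite -ler_norml -(expr_le1 (n := 2))// real_normK ?num_real// -ab lerDl sqr_ge0.
have sqrt_b : Num.sqrt (1 - a ^+ 2) = `|b|.
  by rewrite -ab addrAC subrr add0r sqrtr_sqr.
have [b0|b0] := leP 0 b; [exists (acos a)|exists (- acos a)].
  by rewrite /expi acosK ?in_itv//= sin_acos// sqrt_b ger0_norm.
by rewrite /expi cosN sinN acosK ?in_itv//= sin_acos// sqrt_b ltr0_norm// opprK.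
Qed.

Lemma expi_inj_lt_pi x y : `|x - y| < pi -> expi x = expi y -> x = y.
Proof.
move=> xy e; have : expi (x - y) = 1.
  by rewrite expiD expiN e mulcJ normc_expi expr1n.
case=> c _; apply/eqP; rewrite -subr_eq0 -normr_eq0; apply/eqP.
apply: cos_inj; rewrite ?in_itv/= ?normr_ge0 ?lexx ?pi_ge0 ?ltW//.
by rewrite cos0 -c; case: (ger0P (x - y)) => _; rewrite ?cosN.
Qed.

Lemma cexpE z : cexp z = (expR (Re z))%:C * expi (Im z).
Proof. by []. Qed.

Lemma cexpD z w : cexp (z + w) = cexp z * cexp w.
Proof. by rewrite !cexpE ReD ImD expRD rmorphM/= expiD mulrACA. Qed.

Lemma cexp0 : cexp (0 : R[i]) = 1.
Proof. by rewrite cexpE /= expR0 expi0 mulr1. Qed.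

Lemma normc_cexp z : normc (cexp z) = expR (Re z).
Proof. by rewrite cexpE normcM_expi normcR ger0_norm ?expR_ge0. Qed.

Lemma cexp_neq0 z : cexp z != 0.
Proof. by rewrite -normc_gt0 normc_cexp expR_gt0. Qed.

Lemma cexpN z : cexp (- z) = (cexp z)^-1.
Proof.
by apply: (mulfI (cexp_neq0 z)); rewrite -cexpD subrr cexp0 divff ?cexp_neq0.
Qed.

Lemma cexp_ln x : 0 < x -> cexp (ln x)%:C = x%:C.
Proof. by move=> x0; rewrite cexpE/= lnK// expi0 mulr1. Qed.

End ComplexExponential.

Section ComplexLimits.
Variable R : realType.

Definition ctends (T : Type) (F : set_system T) (f : T -> R[i]) (w : R[i]) : Prop :=
  normc (f x - w) @[x --> F] --> (0 : R).

Context {T : Type} {F : set_system T} {FF : Filter F}.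
Implicit Types (f g : T -> R[i]) (z w : R[i]).

Lemma cvg0_le_norm (f g : T -> R) : g x @[x --> F] --> (0 : R) ->
  (forall x, `|f x| <= g x) -> f x @[x --> F] --> (0 : R).
Proof.
move=> g0 fg; apply: norm_cvg0; apply: squeeze_cvgr (cvg_cst 0) g0.
by near=> x; rewrite normr_ge0 fg.
Unshelve. all: by end_near. Qed.

Lemma ctends_ReIm f w :
  ctends F f w <-> Re (f x) @[x --> F] --> Re w /\ Im (f x) @[x --> F] --> Im w.
Proof.
split=> [fw|[fr fi]].
  by split; apply/subr_cvg0; apply: (cvg0_le_norm fw) => x;
    rewrite -?ReN -?ImN -?ReD -?ImD ?le_Re_normc ?le_Im_normc.
apply: (@cvg0_le_norm _ (fun x => `|Re (f x) - Re w| + `|Im (f x) - Im w|)) => [|x].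
  by rewrite -[X in _ --> X]addr0; apply: cvgD; rewrite -(normr0 R);
    apply: cvg_norm; exact/subr_cvg0.
by rewrite ger0_norm ?normc_ge0// -ReN -ImN -ReD -ImD le_normc_ReIm.
Qed.

Lemma ctends_cst z : ctends F (fun=> z) z.
Proof. by rewrite /ctends subrr normc0; exact: cvg_cst. Qed.

Lemma eq_ctends f g z : f =1 g -> ctends F g z -> ctends F f z.
Proof. by move=> /funext->. Qed.

Lemma ctends_near_cst f z : (\forall x \near F, f x = z) -> ctends F f z.
Proof.
by move=> fz; apply: cvg_near_cst; apply: filterS fz => x ->; rewrite subrr normc0.
Qed.

Lemma ctendsD f g z w : ctends F f z -> ctends F g w ->
  ctends F (fun x => f x + g x) (z + w).
Proof.
move=> /ctends_ReIm[fr fi] /ctends_ReIm[gr gi]; apply/ctends_ReIm; split.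
- by under eq_fun do rewrite ReD; rewrite ReD; exact: cvgD.
- by under eq_fun do rewrite ImD; rewrite ImD; exact: cvgD.
Qed.

Lemma ctendsN f z : ctends F f z -> ctends F (fun x => - f x) (- z).
Proof.
move=> fz; apply: (cvg0_le_norm fz) => x.
by rewrite ger0_norm ?normc_ge0// -opprD normcN.
Qed.

Lemma ctendsB f g z w : ctends F f z -> ctends F g w ->
  ctends F (fun x => f x - g x) (z - w).
Proof. by move=> fz gw; apply: ctendsD => //; exact: ctendsN. Qed.

Lemma ctendsJ f z : ctends F f z -> ctends F (fun x => (f x)^*) z^*.
Proof.
move=> fz; apply: (cvg0_le_norm fz) => x.
by rewrite ger0_norm ?normc_ge0// -rmorphB normc_conj.
Qed.

Lemma ctendsM f g z w : ctends F f z -> ctends F g w ->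
  ctends F (fun x => f x * g x) (z * w).
Proof.
move=> /ctends_ReIm[fr fi] /ctends_ReIm[gr gi]; apply/ctends_ReIm; split.
- by under eq_fun do rewrite ReM; rewrite ReM; apply: cvgB; exact: cvgM.
- by under eq_fun do rewrite ImM; rewrite ImM; apply: cvgD; exact: cvgM.
Qed.

Lemma ctendsMl f z w : ctends F f z -> ctends F (fun x => w * f x) (w * z).
Proof. by apply: ctendsM; exact: ctends_cst. Qed.

Lemma ctendsV f z : z != 0 -> ctends F f z -> ctends F (fun x => (f x)^-1) z^-1.
Proof.
move=> z0 /ctends_ReIm[fr fi].
have n0 : Re z ^+ 2 + Im z ^+ 2 != 0 by rewrite -normc_sqr expf_neq0 ?normc_eq0.
have sqV : (Re (f x) ^+ 2 + Im (f x) ^+ 2)^-1 @[x --> F] --> (Re z ^+ 2 + Im z ^+ 2)^-1.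
  by apply: cvgV => //; apply: cvgD; rewrite !expr2; exact: cvgM.
apply/ctends_ReIm; split.
- by under eq_fun do rewrite ReV; rewrite ReV; exact: cvgM.
- by under eq_fun do rewrite ImV; rewrite ImV; apply: cvgN; exact: cvgM.
Qed.

Lemma ctendsX f z n : ctends F f z -> ctends F (fun x => f x ^+ n) (z ^+ n).
Proof.
move=> fz; elim: n => [|n IH]; first exact: ctends_cst.
by rewrite exprS; apply: eq_ctends (ctendsM fz IH) => x; rewrite exprS.
Qed.

Lemma ctends_normc f z : ctends F f z -> normc (f x) @[x --> F] --> normc z.
Proof.
move=> fz; apply/subr_cvg0; apply: (cvg0_le_norm fz) => x /=.
rewrite ler_norml le_normc_dist andbT lerNl opprB.
by rewrite -(normcN (f x - z)) opprB le_normc_dist.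
Qed.

Lemma ctends_real (f : T -> R) (x : R) : f y @[y --> F] --> x ->
  ctends F (fun y => (f y)%:C) x%:C.
Proof. by move=> fx; apply/ctends_ReIm; split => //=; exact: cvg_cst. Qed.

End ComplexLimits.

Lemma ctends_unique (R : realType) (T : Type) (F : set_system T) {FF : ProperFilter F}
    (f : T -> R[i]) z w : ctends F f z -> ctends F f w -> z = w.
Proof.
move=> /ctends_ReIm[zr zi] /ctends_ReIm[wr wi]; apply: complex_ext.
- exact: (cvg_unique _ zr wr).
- exact: (cvg_unique _ zi wi).
Qed.

Section ComplexDerivative.
Variable R : realType.
Implicit Types (f g : R -> R[i]) (t : R).

Definition cderiv f t (d : R[i]) : Prop :=
  is_derive t 1 (fun x => Re (f x)) (Re d) /\ is_derive t 1 (fun x => Im (f x)) (Im d).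

Lemma cderiv_eq f t d d' : cderiv f t d -> d = d' -> cderiv f t d'.
Proof. by move=> + <-. Qed.

Lemma cderiv_cst z t : cderiv (fun=> z) t 0.
Proof. by split; exact: is_derive_cst. Qed.

Lemma cderiv_real t : cderiv (fun x => x%:C) t 1.
Proof. by split; [exact: is_derive_id|exact: is_derive_cst]. Qed.

Lemma cderivD f g t d e : cderiv f t d -> cderiv g t e ->
  cderiv (fun x => f x + g x) t (d + e).
Proof.
move=> [fr fi] [gr gi]; split.
- by under eq_fun do rewrite ReD; rewrite ReD; exact: is_deriveD.
- by under eq_fun do rewrite ImD; rewrite ImD; exact: is_deriveD.
Qed.

Lemma cderivM f g t d e : cderiv f t d -> cderiv g t e ->
  cderiv (fun x => f x * g x) t (d * g t + f t * e).
Proof.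
move=> [fr fi] [gr gi]; split.
- under eq_fun do rewrite ReM; rewrite ReD !ReM.
  refine (is_derive_eq (is_deriveB (is_deriveM fr gr) (is_deriveM fi gi)) _).
  by rewrite /GRing.scale/=; ring.
- under eq_fun do rewrite ImM; rewrite ImD !ImM.
  refine (is_derive_eq (is_deriveD (is_deriveM fr gi) (is_deriveM fi gr)) _).
  by rewrite /GRing.scale/=; ring.
Qed.

Lemma cderivMl z f t d : cderiv f t d -> cderiv (fun x => z * f x) t (z * d).
Proof.
move=> fd; apply: cderiv_eq; first by apply: cderivM fd; exact: cderiv_cst.
by rewrite mul0r add0r.
Qed.

Lemma cderivMr z f t d : cderiv f t d -> cderiv (fun x => f x * z) t (d * z).
Proof. by move=> /(cderivMl z); rewrite mulrC; under eq_fun do rewrite mulrC. Qed.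

Lemma cderivB f g t d e : cderiv f t d -> cderiv g t e ->
  cderiv (fun x => f x - g x) t (d - e).
Proof.
move=> fd gd; rewrite -mulN1r; under eq_fun do rewrite -mulN1r.
by apply: cderivD => //; exact: cderivMl.
Qed.

Lemma cderivX f t d n : cderiv f t d ->
  cderiv (fun x => f x ^+ n.+1) t (n.+1%:R * f t ^+ n * d).
Proof.
move=> fd; elim: n => [|n IH].
  by under eq_fun do rewrite expr1; rewrite expr0 !mul1r.
under eq_fun do rewrite exprS; apply: cderiv_eq; first exact: cderivM fd IH.
by rewrite -[in RHS]natr1 exprS; ring.
Qed.

Lemma cderiv_expi t : cderiv (@expi R) t ('i%C * expi t).
Proof.
split; rewrite ?ReM ?ImM /expi /= !mul0r ?mul1r ?sub0r ?add0r.
- exact: is_derive_cos.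
- exact: is_derive_sin.
Qed.

Lemma cderiv_sub1_expi b t : cderiv (fun x => 1 - b * expi x) t (- (b * ('i%C * expi t))).
Proof.
apply: cderiv_eq; first by apply: cderivB; [exact: cderiv_cst|exact/cderivMl/cderiv_expi].
by rewrite sub0r.
Qed.

Lemma cderiv_ctends f t d : cderiv f t d -> ctends (nbhs t) f (f t).
Proof.
by move=> [fr fi]; apply/ctends_ReIm; split; apply: differentiable_continuous;
  apply/derivable1_diffP; case: fr; case: fi.
Qed.

End ComplexDerivative.

Section ComplexLogarithm.
Variable R : realType.
Implicit Types (w : R[i]).

(* On the right half-plane, the only place where it is used, this is the principal
   branch; there [atan] of the slope is the argument. *)
Definition clog w : R[i] := ln (normc w) +i* atan (Im w / Re w).

Lemma clog1 : clog 1 = 0.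
Proof. by rewrite /clog normc1 ln1/= mul0r atan0. Qed.

Lemma cexp_clog w : 0 < Re w -> cexp (clog w) = w.
Proof.
move=> w0; have nw0 : 0 < normc w.
  by rewrite normc_gt0; apply: contraTneq w0 => ->; rewrite ltxx.
have sec : Num.sqrt (1 + (Im w / Re w) ^+ 2) = normc w / Re w.
  rewrite -[RHS]ger0_norm ?divr_ge0 ?ltW// -sqrtr_sqr; congr Num.sqrt.
  by rewrite !expr_div_n normc_sqr mulrDl divff// expf_neq0// gt_eqF.
have cosE : cos (atan (Im w / Re w)) = Re w / normc w.
  by rewrite cos_atan sec invf_div.
have sinE : sin (atan (Im w / Re w)) = Im w / normc w.
  have := atanK (Im w / Re w); rewrite /tan cosE => /(canRL (divfK _)) ->.
    by field; rewrite !gt_eqF.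
  by rewrite mulf_neq0 ?invr_eq0// gt_eqF.
rewrite cexpE /= lnK// /expi cosE sinE; apply: complex_ext.
  by rewrite ReZ/= mulrC divfK// gt_eqF.
by rewrite ImZ/= mulrC divfK// gt_eqF.
Qed.

Lemma ln_normc w : ln (normc w) = 2^-1 * ln (Re w ^+ 2 + Im w ^+ 2).
Proof.
rewrite -normc_sqr; have [->|w0] := eqVneq w 0.
  by rewrite normc0 expr0n/= ln0// mulr0.
by rewrite lnXn ?normc_gt0// mulr2n; field.
Qed.

Lemma cderiv_clog (f : R -> R[i]) t d : 0 < Re (f t) -> cderiv f t d ->
  cderiv (fun x => clog (f x)) t (d / f t).
Proof.
move=> f0 [fr fi].
have sq0 : 0 < Re (f t) ^+ 2 + Im (f t) ^+ 2.
  by rewrite ltr_pwDl ?sqr_ge0// exprn_gt0.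
split.
- under eq_fun do rewrite /= ln_normc.
  have sqd := is_deriveD (is_deriveX 2 fr) (is_deriveX 2 fi).
  have lnd := is_derive1_comp (f := @ln R) (g := (fun x => Re (f x) ^+ 2 + Im (f x) ^+ 2))
    (is_derive1_ln sq0) sqd.
  refine (is_derive_eq (is_deriveZ 2^-1 lnd) _).
  rewrite ReM ReV ImV /GRing.scale/= !expr1.
  by field; rewrite gt_eqF.
- have vd := is_deriveV (lt0r_neq0 f0) fr.
  have atand := is_derive1_comp (f := @atan R) (g := (fun x => Im (f x) / Re (f x)))
    (is_derive1_atan _) (is_deriveM fi vd).
  refine (is_derive_eq atand _).
  rewrite ImM ReV ImV /GRing.scale/=.
  by field; rewrite !gt_eqF.
Qed.

End ComplexLogarithm.

(** * Integrals over the circle *)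

Section CircleIntegral.
Variable R : realType.
Local Notation lam := (@lebesgue_measure R).
Implicit Types (f g : R -> R[i]) (z w : R[i]).

Lemma twopi_gt0 : 0 < 2 * pi :> R.
Proof. by rewrite mulr_gt0// pi_gt0. Qed.

Lemma twopi_neq0 : (2 * pi)%:C != 0 :> R[i].
Proof. by rewrite fmorph_eq0 gt_eqF// twopi_gt0. Qed.

Lemma lebesgue_I02pi : lam I02pi = (2 * pi)%:E.
Proof. by rewrite lebesgue_measure_itv/= lte_fin twopi_gt0 sube0. Qed.

Lemma cont_integrable (f : R -> R) : continuous f -> lam.-integrable I02pi (EFin \o f).
Proof.
move=> cf; apply: continuous_compact_integrable; first exact: segment_compact.
exact: continuous_subspaceT.
Qed.

Lemma integrable_I02pi_J02pi (f : R -> R) : lam.-integrable I02pi (EFin \o f) ->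
  lam.-integrable J02pi (EFin \o f).
Proof. by apply: integrableS => //; apply: subset_itvl; rewrite bnd_simp. Qed.

Definition ccont f := forall t, ctends (nbhs t) f (f t).

Lemma ccont_Re f : ccont f -> continuous (fun t => Re (f t)).
Proof. by move=> cf t; have /ctends_ReIm[] := cf t. Qed.

Lemma ccont_Im f : ccont f -> continuous (fun t => Im (f t)).
Proof. by move=> cf t; have /ctends_ReIm[] := cf t. Qed.

Lemma ccont_normc f : ccont f -> continuous (fun t => normc (f t)).
Proof. by move=> cf t; exact: ctends_normc (cf t). Qed.

Lemma ccont_cst z : ccont (fun=> z). Proof. by move=> t; exact: ctends_cst. Qed.
Lemma ccontD f g : ccont f -> ccont g -> ccont (fun t => f t + g t).
Proof. by move=> cf cg t; exact: ctendsD. Qed.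
Lemma ccontB f g : ccont f -> ccont g -> ccont (fun t => f t - g t).
Proof. by move=> cf cg t; exact: ctendsB. Qed.
Lemma ccontM f g : ccont f -> ccont g -> ccont (fun t => f t * g t).
Proof. by move=> cf cg t; exact: ctendsM. Qed.
Lemma ccontMl f z : ccont f -> ccont (fun t => z * f t).
Proof. by move=> cf t; exact: ctendsMl. Qed.
Lemma ccontV f : (forall t, f t != 0) -> ccont f -> ccont (fun t => (f t)^-1).
Proof. by move=> f0 cf t; exact: ctendsV. Qed.
Lemma ccontX f n : ccont f -> ccont (fun t => f t ^+ n).
Proof. by move=> cf t; exact: ctendsX. Qed.
Lemma ccontJ f : ccont f -> ccont (fun t => (f t)^*).
Proof. by move=> cf t; exact: ctendsJ. Qed.
Lemma ccont_real (f : R -> R) : continuous f -> ccont (fun t => (f t)%:C).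
Proof. by move=> cf t; apply: ctends_real; exact: cf. Qed.
Lemma ccont_expi : ccont (@expi R).
Proof. by move=> t; apply: cderiv_ctends; exact: cderiv_expi. Qed.

Definition circle_int f : R[i] :=
  (\int[lam]_(t in I02pi) Re (f t)) +i* (\int[lam]_(t in I02pi) Im (f t)).

Lemma circle_intD f g : ccont f -> ccont g ->
  circle_int (fun t => f t + g t) = circle_int f + circle_int g.
Proof.
move=> cf cg; apply: complex_ext; rewrite ?ReD ?ImD /=.
- under eq_Rintegral do rewrite ReD.
  by rewrite RintegralD//; apply: cont_integrable; exact: ccont_Re.
- under eq_Rintegral do rewrite ImD.
  by rewrite RintegralD//; apply: cont_integrable; exact: ccont_Im.
Qed.

Lemma circle_intZ z f : ccont f -> circle_int (fun t => z * f t) = z * circle_int f.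
Proof.
move=> cf.
have ir := cont_integrable (ccont_Re cf); have ii := cont_integrable (ccont_Im cf).
have integrableZ (k : R) (g : R -> R) : lam.-integrable I02pi (EFin \o g) ->
    lam.-integrable I02pi (EFin \o (fun t => k * g t)).
  have mI : measurable (I02pi : set (measurableTypeR R)) by [].
  exact: (integrableZl mI k).
apply: complex_ext; rewrite ?ReM ?ImM /=.
- under eq_Rintegral do rewrite ReM.
  by rewrite RintegralB ?RintegralZl//; exact: integrableZ.
- under eq_Rintegral do rewrite ImM.
  by rewrite RintegralD ?RintegralZl//; exact: integrableZ.
Qed.

Lemma circle_intB f g : ccont f -> ccont g ->
  circle_int (fun t => f t - g t) = circle_int f - circle_int g.
Proof.
move=> cf cg; rewrite -(mulN1r (circle_int g)) -circle_intZ// -circle_intD//.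
  by congr circle_int; apply/funext => t; rewrite mulN1r.
exact: ccontMl.
Qed.

Lemma circle_intJ f : ccont f -> circle_int (fun t => (f t)^*) = (circle_int f)^*.
Proof.
move=> cf; apply: complex_ext; rewrite ?ReJ ?ImJ /=.
- by under eq_Rintegral do rewrite ReJ.
- under eq_Rintegral do rewrite ImJ -mulN1r.
  by rewrite RintegralZl ?mulN1r//; apply: cont_integrable; exact: ccont_Im.
Qed.

Lemma circle_int_cst z : circle_int (fun=> z) = (2 * pi)%:C * z.
Proof.
by apply: complex_ext; rewrite ?ReZ ?ImZ /= Rintegral_cst//= lebesgue_I02pi/= mulrC.
Qed.

Lemma Rintegral_I02pi_deriv (F f : R -> R) : continuous f ->
  (forall t : R, is_derive t 1 F (f t)) ->
  \int[lam]_(t in I02pi) f t = F (2 * pi) - F 0.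
Proof.
move=> cf dF; rewrite /Rintegral (@continuous_FTC2 _ f F)//.
- exact: twopi_gt0.
- exact: continuous_subspaceT.
- have cF t : F x @[x --> t] --> F t.
    by apply: differentiable_continuous; apply/derivable1_diffP; case: (dF t).
  split.
  + by move=> t _; case: (dF t).
  + by apply: cvg_at_right_filter; exact: cF.
  + by apply: cvg_at_left_filter; exact: cF.
- by move=> t _; rewrite derive1E; exact: derive_val.
Qed.

Lemma circle_int_deriv F f : (forall t, cderiv F t (f t)) -> ccont f ->
  circle_int f = F (2 * pi) - F 0.
Proof.
move=> dF cf; apply: complex_ext; rewrite ?ReD ?ImD ?ReN ?ImN /=.
- apply: (@Rintegral_I02pi_deriv (fun t => Re (F t))); first exact: ccont_Re.
  by move=> t; case: (dF t).
- apply: (@Rintegral_I02pi_deriv (fun t => Im (F t))); first exact: ccont_Im.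
  by move=> t; case: (dF t).
Qed.

Lemma circle_int_expiX n : circle_int (fun t => expi t ^+ n.+1) = 0.
Proof.
rewrite (@circle_int_deriv (fun t => (n.+1%:R * 'i%C)^-1 * expi t ^+ n.+1)).
- by rewrite expi0 expi2pi !expr1n subrr.
- move=> t; apply: cderiv_eq; first by apply/cderivMl/cderivX/cderiv_expi.
  have : n.+1%:R != 0 :> R[i] by rewrite pnatr_eq0.
  by rewrite exprS; move: n.+1%:R => k k0; field; rewrite k0 imaginary_unit_neq0.
- exact/ccontX/ccont_expi.
Qed.

Lemma le_normc_circle_int f : ccont f ->
  normc (circle_int f) <= 2 * \int[lam]_(t in I02pi) normc (f t).
Proof.
move=> cf; have inf := cont_integrable (ccont_normc cf).
have bound (g : R -> R) : continuous g -> (forall t, `|g t| <= normc (f t)) ->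
    `|\int[lam]_(t in I02pi) g t| <= \int[lam]_(t in I02pi) normc (f t).
  move=> cg gf; apply: le_trans (le_normr_Rintegral _ (cont_integrable cg)) _ => //.
  apply: le_Rintegral => //; apply: cont_integrable => t.
  by apply: cvg_norm; exact: cg.
rewrite mulr_natl mulr2n (le_trans (le_normc_ReIm _))// lerD//; apply: bound.
- exact: ccont_Re.
- by move=> t; exact: le_Re_normc.
- exact: ccont_Im.
- by move=> t; exact: le_Im_normc.
Qed.

End CircleIntegral.

Section AnalyticTrace.
Variable R : realType.
Local Notation lam := (@lebesgue_measure R).
Implicit Types (f g : R -> R[i]) (z w b : R[i]).

(* The continuous functions on the circle whose Fourier coefficients of negative
   index vanish, that is, the boundary values of the analytic functions of the disc
   that are continuous up to the boundary. *)
Definition analytic_trace f :=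
  ccont f /\ forall n, circle_int (fun t => expi t ^+ n.+1 * f t) = 0.

Lemma analytic_trace_cst z : analytic_trace (fun=> z).
Proof.
split=> [|n]; first exact: ccont_cst.
under eq_fun do rewrite mulrC.
by rewrite circle_intZ ?circle_int_expiX ?mulr0//; exact/ccontX/ccont_expi.
Qed.

Lemma analytic_trace_expiM f : analytic_trace f -> analytic_trace (fun t => expi t * f t).
Proof.
move=> [cf f0]; split=> [|n]; first exact/ccontM/cf/ccont_expi.
by under eq_fun do rewrite mulrA -exprSr.
Qed.

Lemma analytic_traceZ z f : analytic_trace f -> analytic_trace (fun t => z * f t).
Proof.
move=> [cf f0]; split=> [|n]; first exact: ccontMl.
under eq_fun do rewrite mulrCA.
by rewrite circle_intZ ?f0 ?mulr0//; exact/ccontM/cf/ccontX/ccont_expi.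
Qed.

Lemma ccont_sub1_expi b : ccont (fun t => 1 - b * expi t).
Proof. exact/ccontB/ccontMl/ccont_expi/ccont_cst. Qed.

Lemma le0_geometric (x q M : R) : 0 <= q < 1 -> (forall n, x <= q ^+ n * M) -> x <= 0.
Proof.
move=> /andP[q0 q1] xq; rewrite -(mul0r M).
have qM0 : q ^+ n * M @[n --> \oo] --> 0 * M.
  by apply: cvgM (cvg_cst _); apply: cvg_expr; rewrite ger0_norm.
by apply: (cvgr_to_ge qM0); apply: nearW.
Qed.

(* The integrals J n of [expi t ^+ n.+1 * f t / (1 - b * expi t)] are bounded and
   satisfy J n = b * J n.+1. *)
Lemma analytic_trace_div_sub1 b f : normc b < 1 -> analytic_trace f ->
  analytic_trace (fun t => f t / (1 - b * expi t)).
Proof.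
move=> b1 [cf f0]; set g := (fun t => _ / _).
have cg : ccont g.
  by apply: ccontM => //; apply: ccontV (@ccont_sub1_expi b) => t; exact: sub1_expi_neq0.
have cXg n : ccont (fun t => expi t ^+ n * g t) by exact/ccontM/cg/ccontX/ccont_expi.
pose J n := circle_int (fun t => expi t ^+ n.+1 * g t).
have JS n : J n = b * J n.+1.
  apply/eqP; rewrite -subr_eq0 -circle_intZ// -circle_intB//; last exact: ccontMl.
  rewrite -(f0 n); apply/eqP; congr circle_int; apply/funext => t.
  by rewrite /g !exprS; field; exact: sub1_expi_neq0.
have JX m n : J n = b ^+ m * J (n + m)%N.
  elim: m n => [|m IH] n; first by rewrite expr0 mul1r addn0.
  by rewrite JS IH exprS -mulrA addSnnS.
split=> // n; apply/eqP; rewrite -normc_eq0 eq_le normc_ge0 andbT.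
apply: (@le0_geometric _ (normc b) (2 * \int[lam]_(t in I02pi) normc (g t))).
  by rewrite normc_ge0.
move=> m; rewrite -/(J n) (JX m) normcM normcX ler_wpM2l ?exprn_ge0 ?normc_ge0//.
apply: le_trans (le_normc_circle_int (cXg _)) _.
by under eq_Rintegral do rewrite normcM normcX normc_expi expr1n mul1r.
Qed.

Lemma analytic_trace_outer_pole b : normc b < 1 ->
  analytic_trace (fun t => (1 - b * expi t)^-1).
Proof.
move=> b1; under eq_fun do rewrite -[_^-1]mul1r.
exact/analytic_trace_div_sub1/analytic_trace_cst.
Qed.

Lemma circle_int_expiM f : analytic_trace f -> circle_int (fun t => expi t * f t) = 0.
Proof. by case=> _ /(_ 0%N); under eq_fun do rewrite expr1. Qed.

Lemma ccont_inner_pole z : normc z < 1 -> ccont (fun t => (expi t - z)^-1).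
Proof.
move=> z1; apply: ccontV => [t|]; first exact: expi_sub_neq0.
exact/ccontB/ccont_cst/ccont_expi.
Qed.

Lemma conj_outer_pole z t : normc z < 1 ->
  (expi t / (1 - z^* * expi t))^* = (expi t - z)^-1.
Proof.
move=> z1; rewrite rmorphM fmorphV rmorphB rmorph1 rmorphM/= conjCK conj_expi.
by field; rewrite expi_neq0 expi_sub_neq0.
Qed.

Lemma circle_int_conj_inner_pole f z : normc z < 1 -> analytic_trace f ->
  circle_int (fun t => (f t)^* / (expi t - z)) = 0.
Proof.
move=> z1 af; have zJ1 : normc z^* < 1 by rewrite normc_conj.
have ag := analytic_trace_div_sub1 zJ1 af.
under eq_fun do rewrite -conj_outer_pole// -rmorphM mulrCA.
rewrite circle_intJ; first by rewrite circle_int_expiM ?rmorph0.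
by case: (analytic_trace_expiM ag).
Qed.

Lemma circle_int_inner_pole z : normc z < 1 -> circle_int (fun t => (expi t - z)^-1) = 0.
Proof.
move=> z1; have := circle_int_conj_inner_pole z1 (analytic_trace_cst 1).
by under eq_fun do rewrite rmorph1 mul1r.
Qed.

Lemma circle_int_outer_pole b : normc b < 1 ->
  circle_int (fun t => (1 - b * expi t)^-1) = (2 * pi)%:C.
Proof.
move=> b1; have ag := analytic_trace_outer_pole b1.
rewrite (_ : (fun _ => _) = (fun t => 1 + b * (expi t / (1 - b * expi t)))); last first.
  by apply/funext => t; field; rewrite sub1_expi_neq0.
have [cg _] := analytic_trace_expiM ag.
rewrite circle_intD; [|exact: ccont_cst|exact: ccontMl].
by rewrite circle_int_cst circle_intZ// circle_int_expiM// mulr0 addr0 mulr1.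
Qed.

Lemma cauchy_outer_pole z b : normc z < 1 -> normc b < 1 ->
  circle_int (fun t => expi t / (1 - b * expi t) / (expi t - z)) =
  (2 * pi)%:C / (1 - b * z).
Proof.
move=> z1 b1; have bz : 1 - b * z != 0 by apply: sub1_neq0; rewrite normcM_lt1// ltW.
rewrite (_ : (fun _ => _) = (fun t => (1 - b * z)^-1 *
    (z * (expi t - z)^-1 + (1 - b * expi t)^-1))); last first.
  by apply/funext => t; field; rewrite bz sub1_expi_neq0// expi_sub_neq0.
have ci := ccontMl z (ccont_inner_pole z1).
have [co _] := analytic_trace_outer_pole b1.
rewrite circle_intZ; last exact: ccontD.
rewrite circle_intD// circle_intZ; last exact: ccont_inner_pole.
by rewrite circle_int_inner_pole// circle_int_outer_pole// mulr0 add0r mulrC.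
Qed.

Lemma herglotz_kernelE t z : normc z < 1 ->
  herglotz_kernel t z = 1 + 2 * z / (expi t - z).
Proof. by move=> z1; rewrite /herglotz_kernel; field; rewrite expi_sub_neq0. Qed.

Lemma ccont_herglotz_kernel z : normc z < 1 -> ccont (fun t => herglotz_kernel t z).
Proof.
move=> z1; under eq_fun do rewrite herglotz_kernelE//.
exact/ccontD/ccontMl/ccont_inner_pole/z1/ccont_cst.
Qed.

Lemma circle_int_herglotz_Re f z : normc z < 1 -> analytic_trace f ->
  circle_int (fun t => herglotz_kernel t z * (Re (f t))%:C) =
  (Re (circle_int f))%:C + z * circle_int (fun t => f t / (expi t - z)).
Proof.
move=> z1 af; have [cf _] := af; have cJ := ccontJ cf; have ci := ccont_inner_pole z1.
rewrite (_ : (fun _ => _) = (fun t => 2^-1 * (f t + (f t)^*) +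
    (z * (f t / (expi t - z)) + z * ((f t)^* / (expi t - z))))); last first.
  by apply/funext => t; rewrite herglotz_kernelE// ReJ_add; field; exact: expi_sub_neq0.
have cfi := ccontM cf ci; have cJi := ccontM cJ ci.
rewrite circle_intD; [|exact/ccontMl/ccontD|by apply: ccontD; exact: ccontMl].
rewrite circle_intZ; last exact: ccontD.
rewrite circle_intD// circle_intJ//.
rewrite circle_intD; [|exact: ccontMl|exact: ccontMl].
by rewrite !circle_intZ// circle_int_conj_inner_pole// mulr0 addr0 ReJ_add mulrC.
Qed.

Lemma circle_int_herglotz_kernel z : normc z < 1 ->
  circle_int (fun t => herglotz_kernel t z) = (2 * pi)%:C.
Proof.
move=> z1; have := circle_int_herglotz_Re z1 (analytic_trace_cst 1).
under eq_fun do rewrite mulr1; under [X in _ = _ + _ * circle_int X]eq_fun do rewrite mul1r.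
by rewrite circle_int_inner_pole// mulr0 addr0 => ->; rewrite circle_int_cst mulr1.
Qed.

Lemma circle_int_herglotz_outer_pole z b c : normc z < 1 -> normc b < 1 ->
  circle_int (fun t => herglotz_kernel t z * (Re (c * (expi t / (1 - b * expi t))))%:C) =
  (2 * pi)%:C * (c * z / (1 - b * z)).
Proof.
move=> z1 b1; have ag := analytic_trace_outer_pole b1.
have ae := analytic_trace_expiM ag; have [ce _] := ae.
rewrite circle_int_herglotz_Re//; last exact: analytic_traceZ.
rewrite circle_intZ// circle_int_expiM// mulr0 add0r.
under eq_fun do rewrite -mulrA.
rewrite circle_intZ; last exact/ccontM/ccont_inner_pole.
by rewrite cauchy_outer_pole//; ring.
Qed.

End AnalyticTrace.

(** * Herglotz integrals and outer functions *)

Section DifferentiationUnderCircleIntegral.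
Variable R : realType.
Local Notation lam := (@lebesgue_measure R).
Implicit Types (x u v M : R).

Lemma is_derive_Rintegral_I02pi (f df : R -> R -> R) u v M x : x \in `]u, v[ ->
  (forall y, y \in `]u, v[ -> continuous (f y)) ->
  (forall y t, y \in `]u, v[ -> is_derive y 1 (f ^~ t) (df y t)) ->
  (forall y t, y \in `]u, v[ -> `|df y t| <= M) ->
  is_derive x 1 (fun y => \int[lam]_(t in I02pi) f y t) (\int[lam]_(t in I02pi) df x t).
Proof.
move=> xuv cf dfP dfM.
have M0 : 0 <= M by apply: le_trans (dfM x 0 xuv).
have partialE y t : y \in `]u, v[ -> partial1of2 f y t = df y t.
  by move=> yuv; rewrite partial1of2E; have := dfP y t yuv => ?; exact: derive_val.
have mI : measurable (I02pi : set R) by [].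
have intf y : `]u, v[%classic y -> lam.-integrable I02pi (EFin \o f y).
  by move=> yuv; apply: cont_integrable; exact: cf.
have derf y (t : R) : `]u, v[%classic y -> I02pi t -> derivable (f ^~ t) y 1.
  by move=> yuv _; case: (dfP y t yuv).
have intM : lam.-integrable I02pi (EFin \o cst M).
  by apply: cont_integrable => t; exact: cvg_cst.
have partialM y (t : R) : `]u, v[%classic y -> I02pi t -> `|partial1of2 f y t| <= cst M t.
  by move=> yuv _; rewrite partialE// dfM.
have M0' (t : R) : 0 <= cst M t by [].
have Ix : `]u, v[%classic x by [].
apply: DeriveDef.
  exact: (@derivable_under_integral R _ _ lam f I02pi mI x u v Ix intf derf
    (cst M) M0' intM partialM).
rewrite -derive1E (@differentiation_under_integral R _ _ lam f I02pi mI x u v Ix intf derf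
  (cst M) M0' intM partialM).
by apply: eq_Rintegral => t _; rewrite partialE.
Qed.

Lemma cderiv_circle_int (f df : R -> R -> R[i]) u v M x : x \in `]u, v[ ->
  (forall y, y \in `]u, v[ -> ccont (f y)) ->
  (forall y t, y \in `]u, v[ -> cderiv (f ^~ t) y (df y t)) ->
  (forall y t, y \in `]u, v[ -> normc (df y t) <= M) ->
  cderiv (fun y => circle_int (f y)) x (circle_int (df x)).
Proof.
move=> xuv cf dfP dfM; split.
- apply: (@is_derive_Rintegral_I02pi (fun y t => Re (f y t)) (fun y t => Re (df y t))
      _ _ _ _ xuv).
  + by move=> y yuv; apply: ccont_Re; exact: cf.
  + by move=> y t yuv; case: (dfP y t yuv).
  + by move=> y t yuv; apply: le_trans (le_Re_normc _) (dfM _ _ yuv).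
- apply: (@is_derive_Rintegral_I02pi (fun y t => Im (f y t)) (fun y t => Im (df y t))
      _ _ _ _ xuv).
  + by move=> y yuv; apply: ccont_Im; exact: cf.
  + by move=> y t yuv; case: (dfP y t yuv).
  + by move=> y t yuv; apply: le_trans (le_Im_normc _) (dfM _ _ yuv).
Qed.

Lemma is_derive0_eq (f : R -> R) u v (x y : R) :
  (forall z, z \in `]u, v[ -> is_derive z 1 f 0) ->
  x \in `]u, v[ -> y \in `]u, v[ -> x < y -> f x = f y.
Proof.
rewrite !in_itv/= => df /andP[ux _] /andP[_ yv] xy.
have sub z : z \in `[x, y] -> z \in `]u, v[.
  by rewrite !in_itv/= => /andP[xz zy]; rewrite (lt_le_trans ux)// (le_lt_trans zy).
have dfxy (z : R) : z \in `]x, y[ -> is_derive z 1 f ((cst 0 : R -> R) z).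
  by move=> zxy; apply/df/sub; exact: subset_itv_oo_cc.
have cf : {within `[x, y], continuous f}.
  by apply: derivable_within_continuous => z /sub /df h; case: h.
have [z _] := MVT xy dfxy cf.
by move/eqP; rewrite mul0r subr_eq0 => /eqP.
Qed.

Lemma cderiv0_eq (f : R -> R[i]) u v (x y : R) :
  (forall z, z \in `]u, v[ -> cderiv f z 0) ->
  x \in `]u, v[ -> y \in `]u, v[ -> x < y -> f x = f y.
Proof.
move=> df xuv yuv xy; apply: complex_ext.
- by apply: (@is_derive0_eq (fun x => Re (f x)) u v) => // z /df[].
- by apply: (@is_derive0_eq (fun x => Im (f x)) u v) => // z /df[].
Qed.

End DifferentiationUnderCircleIntegral.

Section HerglotzIntegral.
Variable R : realType.
Local Notation lam := (@lebesgue_measure R).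
Local Notation T := (measurableTypeR R).
Implicit Types (z : R[i]) (nu : {measure set T -> \bar R}) (h k : R -> R).

Lemma normc_herglotz_kernel (t : R) z : in_disc z ->
  normc (herglotz_kernel t z) <= 2 / (1 - normc z).
Proof.
move=> z1; have z1' : 0 < 1 - normc z by rewrite subr_gt0.
rewrite /herglotz_kernel normcM normcV ler_pM ?invr_ge0 ?normc_ge0//.
  by apply: (le_trans (le_normcD _ _)); rewrite normc_expi; move: z1; rewrite /in_disc; lra.
rewrite lef_pV2 ?posrE ?normc_gt0 ?expi_sub_neq0//.
by apply: le_trans (le_normc_dist _ _); rewrite normc_expi.
Qed.

Lemma Re_herglotz_kernel_ge0 (t : R) z : in_disc z -> 0 <= Re (herglotz_kernel t z).
Proof.
move=> z1; rewrite /herglotz_kernel ReM ReV ImV.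
set n2 := _ ^+ 2 + _ ^+ 2.
rewrite [leRHS](_ : _ = (normc (expi t) ^+ 2 - normc z ^+ 2) / n2).
  rewrite normc_expi expr1n; apply: divr_ge0; last by rewrite addr_ge0 ?sqr_ge0.
  by rewrite subr_ge0 expr_le1 ?normc_ge0// ltW.
by rewrite !normc_sqr !ReD !ImD !ReN !ImN; ring.
Qed.

Lemma integrable_bounded_mul nu (g k : R -> R) (M : R) : continuous g ->
  (forall t, `|g t| <= M) -> nu.-integrable J02pi (EFin \o k) ->
  nu.-integrable J02pi (EFin \o (fun t => g t * k t)).
Proof.
move=> cg gM ik; have mJ : measurable (J02pi : set T) by [].
apply: (integrableMr (g := EFin \o k) mJ (h := g)) => //.
  by apply: measurable_funTS; exact: continuous_measurable_fun.
exists M; split; first exact: num_real.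
by move=> x Mx t _ /=; apply: (le_trans (gM t)); exact: ltW.
Qed.

Lemma integrable_Re_herglotz nu k z : in_disc z -> nu.-integrable J02pi (EFin \o k) ->
  nu.-integrable J02pi (EFin \o (fun t => Re (herglotz_kernel t z) * k t)).
Proof.
move=> z1 ik; apply: (@integrable_bounded_mul _ _ _ (2 / (1 - normc z))) => //.
  by apply: ccont_Re; exact: ccont_herglotz_kernel.
by move=> t; apply: (le_trans (le_Re_normc _)); exact: normc_herglotz_kernel.
Qed.

Lemma integrable_Im_herglotz nu k z : in_disc z -> nu.-integrable J02pi (EFin \o k) ->
  nu.-integrable J02pi (EFin \o (fun t => Im (herglotz_kernel t z) * k t)).
Proof.
move=> z1 ik; apply: (@integrable_bounded_mul _ _ _ (2 / (1 - normc z))) => //.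
  by apply: ccont_Im; exact: ccont_herglotz_kernel.
by move=> t; apply: (le_trans (le_Im_normc _)); exact: normc_herglotz_kernel.
Qed.

Lemma Re_herglotz nu k z :
  Re (herglotz nu k z) = \int[nu]_(t in J02pi) (Re (herglotz_kernel t z) * k t).
Proof. by []. Qed.

Lemma Im_herglotz nu k z :
  Im (herglotz nu k z) = \int[nu]_(t in J02pi) (Im (herglotz_kernel t z) * k t).
Proof. by []. Qed.

Lemma herglotzD nu h k z : in_disc z -> nu.-integrable J02pi (EFin \o h) ->
  nu.-integrable J02pi (EFin \o k) ->
  herglotz nu (fun t => h t + k t) z = herglotz nu h z + herglotz nu k z.
Proof.
move=> z1 ih ik; apply: complex_ext.
- rewrite ReD !Re_herglotz -RintegralD//; try exact: integrable_Re_herglotz.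
  by apply: eq_Rintegral => t _; rewrite mulrDr.
- rewrite ImD !Im_herglotz -RintegralD//; try exact: integrable_Im_herglotz.
  by apply: eq_Rintegral => t _; rewrite mulrDr.
Qed.

Lemma herglotzZ nu (c : R) k z : in_disc z -> nu.-integrable J02pi (EFin \o k) ->
  herglotz nu (fun t => c * k t) z = c%:C * herglotz nu k z.
Proof.
move=> z1 ik; apply: complex_ext.
- rewrite ReZ !Re_herglotz -RintegralZl//; last exact: integrable_Re_herglotz.
  by apply: eq_Rintegral => t _; rewrite mulrCA.
- rewrite ImZ !Im_herglotz -RintegralZl//; last exact: integrable_Im_herglotz.
  by apply: eq_Rintegral => t _; rewrite mulrCA.
Qed.

Lemma le_Re_herglotz nu h k z : in_disc z -> nu.-integrable J02pi (EFin \o h) ->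
  nu.-integrable J02pi (EFin \o k) -> (forall t, h t <= k t) ->
  Re (herglotz nu h z) <= Re (herglotz nu k z).
Proof.
move=> z1 ih ik hk; rewrite !Re_herglotz; apply: le_Rintegral => //.
- exact: integrable_Re_herglotz.
- exact: integrable_Re_herglotz.
- by move=> t _; rewrite ler_wpM2l// Re_herglotz_kernel_ge0.
Qed.

Lemma Re_herglotz_ge0 nu k z : in_disc z -> (forall t, 0 <= k t) ->
  0 <= Re (herglotz nu k z).
Proof.
move=> z1 k0; rewrite Re_herglotz; apply: Rintegral_ge0 => t _.
by rewrite mulr_ge0// Re_herglotz_kernel_ge0.
Qed.

Lemma Re_herglotz_bound nu k z : in_disc z -> nu.-integrable J02pi (EFin \o k) ->
  `|Re (herglotz nu k z)| <= 2 / (1 - normc z) * \int[nu]_(t in J02pi) `|k t|.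
Proof.
move=> z1 ik; have mJ : measurable (J02pi : set T) by [].
have iK := integrable_Re_herglotz z1 ik.
have ink : nu.-integrable J02pi (EFin \o (fun t => `|k t|)) by exact: integrable_norm.
rewrite Re_herglotz (le_trans (le_normr_Rintegral mJ iK))// -RintegralZl//.
apply: le_Rintegral => //; first exact: integrable_norm.
  exact: (integrableZl mJ _ ink).
move=> t _; rewrite normrM ler_wpM2r//.
by apply: (le_trans (le_Re_normc _)); exact: normc_herglotz_kernel.
Qed.

Lemma herglotz_null nu k z : in_disc z -> nu.-integrable J02pi (EFin \o k) ->
  nu J02pi = 0%E -> herglotz nu k z = 0.
Proof.
move=> z1 ik nu0; rewrite /herglotz !null_set_integral//.
- exact: (measurable_int nu (integrable_Im_herglotz z1 ik)).
- exact: (measurable_int nu (integrable_Re_herglotz z1 ik)).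
Qed.

Lemma herglotz_circle_int k z : continuous k -> in_disc z ->
  herglotz lam k z = circle_int (fun t => herglotz_kernel t z * (k t)%:C).
Proof.
move=> ck z1; have cK := ccont_herglotz_kernel z1.
apply: complex_ext => /=.
- under [RHS]eq_Rintegral do rewrite mulrC ReZ mulrC.
  apply: Rintegral_itv_bndo_bndc; apply/integrable_I02pi_J02pi/cont_integrable => t.
  by apply: cvgM (ck t); exact: ccont_Re.
- under [RHS]eq_Rintegral do rewrite mulrC ImZ mulrC.
  apply: Rintegral_itv_bndo_bndc; apply/integrable_I02pi_J02pi/cont_integrable => t.
  by apply: cvgM (ck t); exact: ccont_Im.
Qed.

Lemma herglotz_cst (c : R) z : in_disc z ->
  herglotz lam (fun=> c) z = (2 * pi * c)%:C.
Proof.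
move=> z1; rewrite herglotz_circle_int//; last by move=> t; exact: cvg_cst.
under eq_fun do rewrite mulrC.
rewrite circle_intZ; last exact: ccont_herglotz_kernel.
by rewrite circle_int_herglotz_kernel// -rmorphM mulrC.
Qed.

End HerglotzIntegral.

Section OuterFunctions.
Variable R : realType.
Implicit Types (z b w : R[i]) (f g : R[i] -> R[i]).

Lemma cvg_ln (T : Type) (F : set_system T) {FF : Filter F} (f : T -> R) (x : R) :
  0 < x -> f y @[y --> F] --> x -> ln (f y) @[y --> F] --> ln x.
Proof. by move=> x0 fx; apply: continuous_cvg => //; exact: continuous_ln. Qed.

Lemma continuous_ln_normc (f : R -> R[i]) : ccont f -> (forall t, f t != 0) ->
  continuous (fun t => ln (normc (f t))).
Proof.
move=> cf f0 t; apply: cvg_ln; first by rewrite normc_gt0.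
by apply: ctends_normc; exact: cf.
Qed.

Lemma cderiv_clog_sub1 b (x : R) : normc (x%:C * b) < 1 ->
  cderiv (fun y : R => clog (1 - y%:C * b)) x (- b / (1 - x%:C * b)).
Proof.
move=> xb1; apply: cderiv_clog; first exact: Re_1sub_gt0.
apply: cderiv_eq; first by apply: cderivB; [exact: cderiv_cst|exact/cderivMr/cderiv_real].
by rewrite sub0r mul1r.
Qed.

Lemma cderiv_circle_int_herglotz_ln z b (q x : R) : in_disc z -> q * normc b < 1 ->
  x \in `](- q), q[ ->
  cderiv (fun y : R =>
      circle_int (fun t => herglotz_kernel t z * (ln (normc (1 - y%:C * b * expi t)))%:C))
    x ((2 * pi)%:C * (- b * z / (1 - x%:C * b * z))).
Proof.
move=> z1 qb1 xq.
have yb (y : R) : y \in `](- q), q[ -> normc (y%:C * b) <= q * normc b.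
  by rewrite in_itv/= -ltr_norml => yq; rewrite normcM normcR ler_wpM2r ?normc_ge0// ltW.
have yb1 (y : R) : y \in `](- q), q[ -> normc (y%:C * b) < 1.
  by move=> /yb/le_lt_trans; exact.
have qb0 : 0 < 1 - q * normc b by rewrite subr_gt0.
rewrite -circle_int_herglotz_outer_pole//; last exact: yb1.
pose df (y t : R) : R[i] :=
  herglotz_kernel t z * (Re (- b * (expi t / (1 - y%:C * b * expi t))))%:C.
apply: (@cderiv_circle_int _ _ df _ _ (2 / (1 - normc z) * (normc b / (1 - q * normc b)))
  _ xq).
- move=> y yq; apply: ccontM; first exact: ccont_herglotz_kernel.
  apply/ccont_real/continuous_ln_normc; first exact: ccont_sub1_expi.
  by move=> t; apply: sub1_expi_neq0; exact: yb1.
- move=> y t yq; apply: cderivMl.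
  have h : normc (y%:C * (b * expi t)) < 1 by rewrite mulrA normcM_expi yb1.
  have [dRe _] := cderiv_clog_sub1 h; rewrite mulrA mulNr -[y%:C * b * _]mulrA.
  split; last exact: is_derive_cst.
  by under eq_fun do rewrite -mulrA.
- move=> y t yq; rewrite normcM normcR ler_pM ?normc_ge0 ?normc_herglotz_kernel//.
  apply: (le_trans (le_Re_normc _)); rewrite !normcM normcN normcV normc_expi mul1r.
  rewrite ler_wpM2l ?normc_ge0// lef_pV2 ?posrE//; last first.
    by rewrite normc_gt0; apply: sub1_expi_neq0; exact: yb1.
  apply: le_trans (le_normc_dist _ _); rewrite normc1 normcM_expi lerD2l lerN2.
  exact: yb.
Qed.

(* Both sides vanish when [b] is replaced by 0, and they have the same derivative in x
   when [b] is replaced by [x * b]. *)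
Lemma circle_int_herglotz_ln z b : in_disc z -> normc b < 1 ->
  circle_int (fun t => herglotz_kernel t z * (ln (normc (1 - b * expi t)))%:C) =
  (2 * pi)%:C * clog (1 - b * z).
Proof.
move=> z1 b1; have b0 := normc_ge0 b.
pose q := 2 / (1 + normc b).
have q1 : 1 < q by rewrite /q ltr_pdivlMr ?mul1r; lra.
have qb1 : q * normc b < 1 by rewrite /q mulrAC ltr_pdivrMr ?mul1r; lra.
pose Psi (x : R) :=
  circle_int (fun t => herglotz_kernel t z * (ln (normc (1 - x%:C * b * expi t)))%:C) -
  (2 * pi)%:C * clog (1 - x%:C * b * z).
have dPsi x : x \in `](- q), q[ -> cderiv Psi x 0.
  move=> xq; have xb1 : normc (x%:C * (b * z)) < 1.
    move: xq; rewrite in_itv/= -ltr_norml => xq; rewrite mulrA normcM_lt1 ?(ltW z1)//.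
    by rewrite normcM normcR (le_lt_trans _ qb1)// ler_wpM2r// ltW.
  apply: cderiv_eq; first apply: cderivB.
  - exact: cderiv_circle_int_herglotz_ln qb1 xq.
  - by under eq_fun do rewrite -mulrA; apply: cderivMl; exact: cderiv_clog_sub1.
  - by rewrite mulNr -[x%:C * b * z]mulrA subrr.
have Psi01 : Psi 0 = Psi 1 by apply: cderiv0_eq dPsi _ _ _; rewrite ?in_itv/=; lra.
have Psi0 : Psi 0 = 0.
  rewrite /Psi !mul0r subr0 clog1 mulr0 subr0.
  under eq_fun do rewrite !mul0r subr0 normc1 ln1 mulr0.
  by rewrite circle_int_cst mulr0.
by move: Psi01; rewrite Psi0 /Psi mul1r => /esym/eqP; rewrite subr_eq0 => /eqP.
Qed.

Lemma is_outer_neq0 f z : is_outer f -> in_disc z -> f z != 0.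
Proof.
move=> [c [k [c1 [_ fE]]]] z1; rewrite fE// mulf_neq0 ?cexp_neq0//.
by rewrite -normc_gt0 c1.
Qed.

Lemma is_outer_cst w : w != 0 -> is_outer (fun=> w).
Proof.
move=> w0; have nw0 : 0 < normc w by rewrite normc_gt0.
exists (w / (normc w)%:C), (fun=> ln (normc w)); split.
  by rewrite normcM normcV normcR gtr0_norm// divff// gt_eqF.
split; first by apply: cont_integrable => t; exact: cvg_cst.
move=> z z1; rewrite herglotz_cst// -rmorphM mulKf ?gt_eqF ?twopi_gt0// cexp_ln//.
by rewrite divfK// fmorph_eq0 gt_eqF.
Qed.

Lemma is_outerM f g : is_outer f -> is_outer g -> is_outer (fun z => f z * g z).
Proof.
move=> [c [h [c1 [ih fE]]]] [d [k [d1 [ik gE]]]].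
exists (c * d), (fun t => h t + k t); split; first by rewrite normcM c1 d1 mulr1.
have mI : measurable (I02pi : set (measurableTypeR R)) by [].
split; first exact: (integrableD mI ih ik).
move=> z z1; rewrite herglotzD//; try exact: integrable_I02pi_J02pi.
by rewrite fE// gE// [in RHS]mulrDr cexpD mulrACA.
Qed.

Lemma is_outerV f : is_outer f -> is_outer (fun z => (f z)^-1).
Proof.
move=> [c [k [c1 [ik fE]]]]; exists c^-1, (fun t => -1 * k t).
split; first by rewrite normcV c1 invr1.
have mI : measurable (I02pi : set (measurableTypeR R)) by [].
split; first exact: (integrableZl mI (-1) ik).
move=> z z1; rewrite herglotzZ//; last exact: integrable_I02pi_J02pi.
by rewrite fE// invfM -cexpN rmorphN1 mulN1r mulrN.
Qed.

Lemma is_outerX f n : is_outer f -> is_outer (fun z => f z ^+ n).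
Proof.
move=> outer_f; elim: n => [|n IH]; first exact: is_outer_cst (oner_neq0 _).
by under eq_fun do rewrite exprS; exact: is_outerM.
Qed.

Lemma is_outer_sub1 b : normc b < 1 -> is_outer (fun z => 1 - b * z).
Proof.
move=> b1; have ck : continuous (fun t : R => ln (normc (1 - b * expi t))).
  apply: continuous_ln_normc; first exact: ccont_sub1_expi.
  by move=> t; exact: sub1_expi_neq0.
exists 1, (fun t => ln (normc (1 - b * expi t))); split; first exact: normc1.
split; first exact: cont_integrable.
move=> z z1; rewrite herglotz_circle_int// circle_int_herglotz_ln//.
rewrite fmorphV mulKf ?twopi_neq0// cexp_clog ?mul1r//.
by apply: Re_1sub_gt0; rewrite normcM_lt1// ltW.
Qed.

End OuterFunctions.

(** * Finite Blaschke products and their phases *)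

Section FiniteBlaschke.
Variable R : realType.
Implicit Types (z b w : R[i]) (zs ws : seq R[i]).

Definition mobius b z : R[i] := (z - b) / (1 - b^* * z).

Definition mobius_prod zs z : R[i] := \prod_(b <- zs) mobius b z.

Definition all_disc zs : bool := all (fun b => normc b < 1) zs.

Lemma mobius_den_neq0 b z : in_disc b -> normc z <= 1 -> 1 - b^* * z != 0.
Proof. by move=> b1 z1; rewrite sub1_neq0// normcM_lt1// normc_conj. Qed.

Lemma mobius_eq0 b z : in_disc b -> normc z <= 1 -> (mobius b z == 0) = (z == b).
Proof.
move=> b1 z1; rewrite /mobius mulf_eq0 invr_eq0 (negbTE (mobius_den_neq0 b1 z1)) orbF.
by rewrite subr_eq0.
Qed.

Lemma mobius0 z : mobius 0 z = z.
Proof. by rewrite /mobius rmorph0 mul0r !subr0 divr1. Qed.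

Lemma mobius_prod_nil z : mobius_prod [::] z = 1.
Proof. exact: big_nil. Qed.

Lemma mobius_prod_cons b zs z : mobius_prod (b :: zs) z = mobius b z * mobius_prod zs z.
Proof. exact: big_cons. Qed.

Lemma mobius_prod_cat zs ws z : mobius_prod (zs ++ ws) z = mobius_prod zs z * mobius_prod ws z.
Proof. exact: big_cat. Qed.

Lemma mobius_prod_perm zs ws z : perm_eq zs ws -> mobius_prod zs z = mobius_prod ws z.
Proof. by move=> zw; exact: perm_big. Qed.

Lemma mobius_prod_nseq0 n z : mobius_prod (nseq n 0) z = z ^+ n.
Proof.
elim: n => [|n IH]; first by rewrite mobius_prod_nil.
by rewrite mobius_prod_cons mobius0 IH exprS.
Qed.

Lemma mobius_prod_eq0 zs z : all_disc zs -> normc z <= 1 ->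
  (mobius_prod zs z == 0) = (z \in zs).
Proof.
move=> + z1; elim: zs => [|b zs IH]; first by rewrite mobius_prod_nil oner_eq0.
by move=> /andP[b1 hz]; rewrite mobius_prod_cons mulf_eq0 inE mobius_eq0// IH.
Qed.

Lemma ctends_mobius (T : Type) (F : set_system T) {FF : Filter F} b (f : T -> R[i]) z :
  in_disc b -> normc z <= 1 -> ctends F f z -> ctends F (fun x => mobius b (f x)) (mobius b z).
Proof.
move=> b1 z1 fz; apply: ctendsM; first by apply: ctendsB => //; exact: ctends_cst.
apply: ctendsV; first exact: mobius_den_neq0.
by apply: ctendsB; [exact: ctends_cst|exact: ctendsMl].
Qed.

Lemma ctends_mobius_prod (T : Type) (F : set_system T) {FF : Filter F} zs (f : T -> R[i]) z :
  all_disc zs -> normc z <= 1 -> ctends F f z ->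
  ctends F (fun x => mobius_prod zs (f x)) (mobius_prod zs z).
Proof.
move=> + z1 fz; elim: zs => [_|b zs IH].
  by rewrite mobius_prod_nil; apply: eq_ctends (ctends_cst _) => x; exact: mobius_prod_nil.
move=> /andP[b1 /IH fzs]; rewrite mobius_prod_cons.
by apply: eq_ctends (ctendsM (ctends_mobius b1 z1 fz) fzs) => x; exact: mobius_prod_cons.
Qed.

Lemma prod_option_eventually_None (a : nat -> option R[i]) (F : R[i] -> R[i]) K n :
  (forall k, (K <= k)%N -> a k = None) -> (K <= n)%N ->
  \prod_(k < n) (match a k with Some w => F w | None => 1 end) =
  \prod_(w <- pmap a (iota 0 K)) F w.
Proof.
move=> aN Kn; pose f k := match a k with Some w => F w | None => 1 end.
rewrite -(big_mkord xpredT f) (big_cat_nat (n := K))//= [X in _ * X]big_nat.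
rewrite [X in _ * X]big1 ?mulr1; last by rewrite /f => k /andP[/aN-> _].
rewrite /index_iota subn0; elim: (iota 0 K) => [|k s IH]; first by rewrite !big_nil.
by rewrite big_cons /f /=; case: (a k) => [w|]; rewrite /= ?big_cons IH// mul1r.
Qed.

Lemma ctends_blaschke_eventually_None (a : nat -> option R[i]) K c m z :
  (forall k, (K <= k)%N -> a k = None) ->
  ctends \oo (fun N => c * z ^+ m *
      \prod_(k < N) match a k with Some w => blaschke_factor w z | None => 1 end)
    (c * z ^+ m * \prod_(w <- pmap a (iota 0 K)) blaschke_factor w z).
Proof.
move=> aN; apply: ctends_near_cst; exists K => // n Kn.
by rewrite (prod_option_eventually_None _ aN).
Qed.

Lemma mobius_blaschke_factor w z : w != 0 ->
  mobius w z = - (w / (normc w)%:C) * blaschke_factor w z.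
Proof.
move=> w0; have n0 : (normc w)%:C != 0 :> R[i] by rewrite fmorph_eq0 normc_eq0.
rewrite /mobius /blaschke_factor mulrA.
rewrite (_ : - (w / (normc w)%:C) * ((normc w)%:C / w) = -1); last by field; rewrite w0 n0.
by rewrite mulN1r -[RHS]mulNr opprB.
Qed.

Lemma mobius_prod_blaschke_factors m ws : 0 \notin ws ->
  exists2 c : R[i], normc c = 1 & forall z,
    mobius_prod (nseq m 0 ++ ws) z = c * z ^+ m * \prod_(w <- ws) blaschke_factor w z.
Proof.
move=> ws0; exists (\prod_(w <- ws) - (w / (normc w)%:C)).
  elim: ws ws0 => [|w ws IH]; first by rewrite big_nil normc1.
  rewrite inE negb_or eq_sym => /andP[w0 ws0]; rewrite big_cons normcM IH// mulr1.
  by rewrite normcN normcM normcV normcR ger0_norm ?normc_ge0// divff// normc_eq0.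
move=> z; rewrite mobius_prod_cat mobius_prod_nseq0 mulrC mulrAC; congr (_ * _).
rewrite -big_split /mobius_prod; apply: eq_big_seq => w ww.
by apply: mobius_blaschke_factor; apply: contraNneq ws0 => <-.
Qed.

Lemma perm_zeros_first zs :
  perm_eq zs (nseq (count_mem 0 zs) 0 ++ [seq b <- zs | b != 0]).
Proof.
rewrite perm_sym (_ : nseq _ _ = [seq b <- zs | b == 0]).
  exact: permEl (perm_filterC (pred1 0) zs).
by elim: zs => //= b zs IH; case: eqVneq => [->|_] //=; rewrite IH.
Qed.

Lemma pmap_onth (T : Type) (s : seq T) : pmap (onth s) (iota 0 (size s)) = s.
Proof.
have SomeI : injective (@Some T) by move=> x y [].
apply: (inj_map SomeI); rewrite pmapS_filter.
have /all_filterP -> : all (onth s) (iota 0 (size s)).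
  by apply/allP => i; rewrite mem_iota onthTE.
by rewrite (eq_map (onthE s)) -(size_map Some s); exact: mkseq_nth.
Qed.

Lemma cvg_series_eventually0 (u : nat -> R) N : (forall n, (N <= n)%N -> u n = 0) ->
  cvg (series u @ \oo).
Proof.
move=> u0; rewrite -(is_cvg_series_restrict N).
under eq_fun do rewrite big_nat big1 => [|k /andP[/u0->]]//.
exact: is_cvg_cst.
Qed.

Lemma is_Blaschke_mobius_prod (c : R[i]) zs : normc c = 1 -> all_disc zs ->
  is_Blaschke (fun z => c * mobius_prod zs z).
Proof.
move=> c1 hz; pose ws := [seq b <- zs | b != 0]; set m := count_mem 0 zs.
have ws0 : 0 \notin ws by rewrite mem_filter eqxx.
have [d d1 dE] := mobius_prod_blaschke_factors m ws0.
have onth_ws k : (size ws <= k)%N -> onth ws k = None by exact: onth_default.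
exists (c * d), m, (onth ws); split; first by rewrite normcM c1 d1 mulr1.
split.
  move=> k w kw; have : w \in ws by apply/onthP; exists k.
  by rewrite mem_filter => /andP[w0 wz]; split => //; exact: (allP hz).
split; first by apply: (@cvg_series_eventually0 _ (size ws)) => k /onth_ws ->.
move=> z _; rewrite (mobius_prod_perm z (perm_zeros_first zs)) dE mulrA (mulrA c).
have := @ctends_blaschke_eventually_None _ (size ws) (c * d) m z onth_ws.
by rewrite pmap_onth.
Qed.

Lemma is_singular_inner_cst (c : R[i]) : normc c = 1 -> is_singular_inner (fun=> c).
Proof.
move=> c1; exists c, (mzero : {measure set (measurableTypeR R) -> \bar R}).
split => //; split => //; split; first by rewrite /mzero ltry.
split.
  by exists set0; split; [exact: measurable0|split => //; rewrite measure0].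
move=> z _; rewrite /herglotz !integral_measure_zero/= (_ : 0 +i* 0 = 0)//.
by rewrite oppr0 cexp0 mulr1.
Qed.

End FiniteBlaschke.

Section BlaschkePhase.
Variable R : realType.
Local Notation lam := (@lebesgue_measure R).
Implicit Types (b w : R[i]) (zs : seq R[i]) (c t : R).

Lemma expi_Im_clog w : 0 < Re w -> expi (- (2 * Im (clog w))) = w^* / w.
Proof.
move=> w0; have w_neq0 : w != 0 by apply: contraTneq w0 => ->; rewrite ltxx.
have nw0 : (normc w)%:C != 0 :> R[i] by rewrite fmorph_eq0 normc_eq0.
have wE : w = (normc w)%:C * expi (Im (clog w)).
  by rewrite -{1}(cexp_clog w0) cexpE /= lnK// posrE normc_gt0.
have nJ : ((normc w)%:C)^* = (normc w)%:C :> R[i] by exact: conjc_real.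
rewrite {2 3}wE rmorphM/= nJ mulr_natl mulr2n opprD expiD !expiN conj_expi.
by field; rewrite nw0 expi_neq0.
Qed.

Definition mobius_phase b t : R := t - 2 * Im (clog (1 - b^* * expi t)).

Definition dmobius_phase b t : R :=
  1 - 2 * Im (- (b^* * ('i%C * expi t)) / (1 - b^* * expi t)).

(* On the circle [mobius b e = e * w^* / w] with [w = 1 - b^* * e]. *)
Lemma expi_mobius_phase b t : in_disc b -> expi (mobius_phase b t) = mobius b (expi t).
Proof.
move=> b1; have bJ1 : normc b^* < 1 by rewrite normc_conj.
have w0 : 0 < Re (1 - b^* * expi t) by apply: Re_1sub_gt0; rewrite normcM_expi.
rewrite expiD expi_Im_clog// rmorphB rmorph1 rmorphM/= conjCK conj_expi /mobius.
by field; rewrite expi_neq0 sub1_expi_neq0.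
Qed.

Lemma is_derive_mobius_phase b t : in_disc b ->
  is_derive t 1 (mobius_phase b) (dmobius_phase b t).
Proof.
move=> b1; have w0 : 0 < Re (1 - b^* * expi t).
  by apply: Re_1sub_gt0; rewrite normcM_expi normc_conj.
have [_ dIm] := cderiv_clog w0 (cderiv_sub1_expi _ t).
exact: (is_deriveB (is_derive_id t 1) (is_deriveZ 2 dIm)).
Qed.

Lemma continuous_dmobius_phase b : in_disc b -> continuous (dmobius_phase b).
Proof.
move=> b1; have bJ1 : normc b^* < 1 by rewrite normc_conj.
have [cw _] := analytic_trace_outer_pole bJ1.
move=> t; apply: cvgB; first exact: cvg_cst.
apply: cvgM; first exact: cvg_cst.
apply: (ccont_Im _ (x := t)); under eq_fun do rewrite -mulNr.
exact/ccontM/cw/ccontMl/ccontMl/ccont_expi.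
Qed.

Definition blaschke_phase c zs t : R := c + \sum_(b <- zs) mobius_phase b t.

Definition dblaschke_phase zs t : R := \sum_(b <- zs) dmobius_phase b t.

Lemma blaschke_phase_nil c : blaschke_phase c [::] = cst c.
Proof. by apply/funext => t; rewrite /blaschke_phase big_nil addr0. Qed.

Lemma blaschke_phase_cons c b zs :
  blaschke_phase c (b :: zs) = (fun t => mobius_phase b t + blaschke_phase c zs t).
Proof. by apply/funext => t; rewrite /blaschke_phase big_cons addrCA. Qed.

Lemma expi_blaschke_phase c zs t : all_disc zs ->
  expi (blaschke_phase c zs t) = expi c * mobius_prod zs (expi t).
Proof.
elim: zs => [|b zs IH]; first by rewrite blaschke_phase_nil mobius_prod_nil mulr1.
move=> /andP[b1 hz].
by rewrite blaschke_phase_cons expiD expi_mobius_phase// IH// mobius_prod_cons mulrCA.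
Qed.

Lemma is_derive_blaschke_phase c zs t : all_disc zs ->
  is_derive t 1 (blaschke_phase c zs) (dblaschke_phase zs t).
Proof.
rewrite /dblaschke_phase; elim: zs => [|b zs IH].
  by move=> _; rewrite blaschke_phase_nil big_nil; exact: is_derive_cst.
move=> /andP[b1 hz]; rewrite blaschke_phase_cons big_cons.
by apply: is_deriveD; [exact: is_derive_mobius_phase|exact: IH].
Qed.

Lemma continuous_dblaschke_phase zs : all_disc zs -> continuous (dblaschke_phase zs).
Proof.
rewrite /dblaschke_phase; elim: zs => [|b zs IH].
  by move=> _ t; under eq_fun do rewrite big_nil; exact: cvg_cst.
move=> /andP[b1 hz] t; under eq_fun do rewrite big_cons.
by apply: cvgD; [exact: continuous_dmobius_phase|exact: IH].
Qed.

Lemma blaschke_phase_period c zs :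
  blaschke_phase c zs (2 * pi) - blaschke_phase c zs 0 = 2 * pi * (size zs)%:R.
Proof.
elim: zs => [|b zs IH]; first by rewrite blaschke_phase_nil subrr mulr0.
rewrite blaschke_phase_cons opprD addrACA IH /= -nat1r.
by rewrite /mobius_phase expi0 expi2pi; ring.
Qed.

Lemma Rintegral_dblaschke_phase zs : all_disc zs ->
  \int[lam]_(t in I02pi) dblaschke_phase zs t = 2 * pi * (size zs)%:R.
Proof.
move=> hz; rewrite -(blaschke_phase_period 0); apply: Rintegral_I02pi_deriv.
  exact: continuous_dblaschke_phase.
by move=> t; exact: is_derive_blaschke_phase.
Qed.

Lemma ctends_radius t : ctends (1 : R)^'- (fun r => r%:C * expi t) (expi t).
Proof.
rewrite -[X in ctends _ _ X]mul1r; apply: ctendsM (ctends_cst _).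
by apply: ctends_real; apply: cvg_at_left_filter; exact: cvg_id.
Qed.

Lemma radial_limit_mobius_prod c zs t : all_disc zs ->
  radial_limit (fun z => expi c * mobius_prod zs z) t (expi (blaschke_phase c zs t)).
Proof.
move=> hz; rewrite expi_blaschke_phase//; apply: ctendsMl.
by apply: ctends_mobius_prod; rewrite ?normc_expi//; exact: ctends_radius.
Qed.

Lemma is_phase_mobius_prod c zs : all_disc zs ->
  is_phase (fun z => expi c * mobius_prod zs z) (blaschke_phase c zs).
Proof.
move=> hz; split; [|split].
- by apply/aeW => t _; exact: radial_limit_mobius_prod.
- by apply/aeW => t _; case: (is_derive_blaschke_phase c t hz).
- rewrite (_ : derive1 _ = dblaschke_phase zs).
    by apply: cont_integrable; exact: continuous_dblaschke_phase.
  by apply/funext => t; have ? := is_derive_blaschke_phase c t hz; rewrite derive1E derive_val.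
Qed.

End BlaschkePhase.

#[local] Instance lebesgue_ae_filter (R : realType) :
  Filter (nbhs (almost_everywhere (@lebesgue_measure R))) :=
  ae_filter_ringOfSetsType (@lebesgue_measure R).

Section PhaseUniqueness.
Variable R : realType.
Local Notation lam := (@lebesgue_measure R).

Lemma ae_interior (P : R -> Prop) :
  {ae lam, forall t, 0 < t < 2 * pi -> P t} -> {ae lam, forall t, I02pi t -> P t}.
Proof.
have ae_neq (x : R) : {ae lam, forall s : R, s != x}.
  exists [set x]; split => //; first exact: lebesgue_measure_set1.
  by move=> s /= /negP; rewrite negbK => /eqP.
move=> aeP; apply: filterS3 aeP (ae_neq 0) (ae_neq (2 * pi)) => t Pt t0 t2 /=.
rewrite in_itv/= => /andP[t0' t2'].
by apply: Pt; rewrite !lt_neqAle eq_sym t0 t0' t2 t2'.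
Qed.

Lemma ae_exists_itv (P : R -> Prop) (x y : R) : x < y ->
  {ae lam, forall t, P t} -> exists2 t, x < t < y & P t.
Proof.
move=> xy [N [mN N0 NP]]; apply: contrapT => noP.
have sub : `]x, y[%classic `<=` N.
  move=> t /=; rewrite in_itv/= => txy; apply: NP => /= Pt.
  by apply: noP; exists t.
have : (lam `]x, y[%classic <= lam N)%E by apply: le_measure; rewrite ?inE.
rewrite N0 lebesgue_measure_itv/= lte_fin xy -EFinB lee_fin leNgt.
by rewrite subr_gt0 xy.
Qed.

Lemma derive_recurrent_value (d : R -> R) (t dd : R) : is_derive t 1 d dd ->
  (forall r, 0 < r -> exists2 s, t < s < t + r & d s = d t) -> dd = 0.
Proof.
move=> dP rec; apply/eqP/negPn/negP => dd0.
have quotient : h^-1 *: (d (h *: 1 + t) - d t) @[h --> 0^'] --> dd.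
  by case: dP => dd1 <-; exact: dd1.
have : \forall h \near (0 : R)^', `|dd - h^-1 *: (d (h *: 1 + t) - d t)| < `|dd|.
  by move/cvgrPdist_lt : quotient; apply; rewrite normr_gt0.
rewrite near_withinE => -[r /= r0 small].
have [s /andP[ts sr] ds] := rec r r0.
have := small (s - t); rewrite /= sub0r normrN {2}/GRing.scale/= mulr1 subrK.
rewrite ds subrr scaler0 subr0 ltxx => h; apply/notF/h; last by rewrite gt_eqF// subr_gt0.
by rewrite gtr0_norm ?subr_gt0//; lra.
Qed.

(* The difference of the two lifts is continuous at [t] and almost everywhere a multiple
   of [2 * pi], so it takes its value at [t] arbitrarily close to [t]. *)
Lemma derive_lift_unique (th Th : R -> R) (dTh t : R) :
  {ae lam, forall s, 0 < s < 2 * pi -> expi (th s) = expi (Th s)} ->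
  0 < t < 2 * pi -> expi (th t) = expi (Th t) ->
  derivable th t 1 -> is_derive t 1 Th dTh -> derive1 th t = dTh.
Proof.
move=> aeE t02 Et dth dTh'; pose d x := th x - Th x.
have idth : is_derive t 1 th (derive1 th t) by apply: DeriveDef => //; rewrite derive1E.
have dd : is_derive t 1 d (derive1 th t - dTh) := is_deriveB idth dTh'.
apply/eqP; rewrite -subr_eq0; apply/eqP; apply: (derive_recurrent_value dd) => r r0.
have cd : d x @[x --> t] --> d t.
  by apply: differentiable_continuous; apply/derivable1_diffP; case: dd.
have near_d : \forall s \near t, `|d s - d t| < pi.
  by move/cvgrPdistC_lt : cd; apply; exact: pi_gt0.
have near_t : \forall s \near t, 0 < s < 2 * pi.
  by have /near_in_itvoo : t \in `]0, (2 * pi)[ by [].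
have [r' /= r'0 near_r'] := filterI near_d near_t.
have rr0 : 0 < Num.min r r' by rewrite lt_min r0.
have [s ts Es] := ae_exists_itv (ltr_pwDr rr0 (lexx t)) aeE.
have /andP[st sr] := ts; move: sr; rewrite -ltrBlDl lt_min => /andP[sr sr'].
have [ds s02] : `|d s - d t| < pi /\ 0 < s < 2 * pi.
  by apply: near_r'; rewrite /= distrC gtr0_norm ?subr_gt0.
exists s; first by rewrite st -ltrBlDl.
have expi_d x : expi (th x) = expi (Th x) -> expi (d x) = 1.
  by move=> ex; rewrite expiD expiN ex mulcJ normc_expi expr1n.
by apply: expi_inj_lt_pi => //; rewrite !expi_d//; exact: Es.
Qed.

Lemma phase_integral_unique (g : R[i] -> R[i]) (th Th dTh : R -> R) :
  continuous dTh -> (forall t : R, is_derive t 1 Th (dTh t)) ->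
  (forall t, radial_limit g t (expi (Th t))) -> is_phase g th ->
  \int[lam]_(t in I02pi) derive1 th t = \int[lam]_(t in I02pi) dTh t.
Proof.
move=> cdTh dThP gTh [gth [dth ith]].
have aeE : {ae lam, forall s, 0 < s < 2 * pi -> expi (th s) = expi (Th s)}.
  by apply: filterS gth => s gs /gs gs'; exact: ctends_unique gs' (gTh s).
rewrite /Rintegral; congr fine; apply: ae_eq_integral => //.
- exact: (measurable_int lam ith).
- exact: (measurable_int lam (cont_integrable cdTh)).
- apply: ae_interior; apply: filterS2 (aeE) dth => t Et dt t02.
  by congr EFin; apply: (derive_lift_unique aeE) => //; [exact: Et|exact: dt].
Qed.

End PhaseUniqueness.

(** * Membership and norm in the Hardy space *)

Section GeometricCoefficients.
Variable R : realType.
Implicit Types (f : R[i] -> R[i]) (b z w : R[i]) (c : nat -> R[i]) (M q r : R).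

(* Such a function extends analytically to a larger disc. *)
Definition has_geometric_coefs f := exists c M q,
  [/\ 0 < q < 1, forall k, normc (c k) <= M * q ^+ k &
      forall z, in_disc z -> ctends \oo (fun N => \sum_(k < N) c k * z ^+ k) (f z)].

Lemma geometric_coefs_in_H2 f : has_geometric_coefs f -> in_H2 f.
Proof.
move=> [c [M [q [/andP[q0 q1] cM cf]]]]; exists c; split=> //.
apply: (@series_le_cvg _ _ (geometric (M ^+ 2) (q ^+ 2))).
- by move=> n; exact: sqr_ge0.
- by move=> n; rewrite /= mulr_ge0 ?sqr_ge0// exprn_ge0// sqr_ge0.
- move=> n; rewrite /geometric/= -exprM mulnC exprM -exprMn.
  by rewrite lerXn2r ?nnegrE ?normc_ge0// (le_trans (normc_ge0 _) (cM n)).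
- by apply: is_cvg_geometric_series; rewrite ger0_norm ?sqr_ge0// expr_lt1// ltW.
Qed.

Lemma geometric_coefs_cst w : has_geometric_coefs (fun=> w).
Proof.
exists (fun k => if k is 0%N then w else 0), (normc w), 2^-1; split.
- by apply/andP; split; lra.
- case=> [|k]; first by rewrite expr0 mulr1.
  by rewrite normc0 mulr_ge0 ?normc_ge0// exprn_ge0.
- move=> z _; apply: ctends_near_cst; exists 1%N => // -[//|n] _.
  by rewrite big_ord_recl/= expr0 mulr1 big1 ?addr0// => i _; rewrite mul0r.
Qed.

Lemma geometric_bound_ge0 c M q : (forall k, normc (c k) <= M * q ^+ k) -> 0 <= M.
Proof. by move=> /(_ 0%N); rewrite expr0 mulr1; exact: le_trans (normc_ge0 _). Qed.

Lemma ctends_geometric_term c M q z : 0 < q < 1 ->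
  (forall k, normc (c k) <= M * q ^+ k) -> in_disc z ->
  ctends \oo (fun k => c k * z ^+ k) 0.
Proof.
move=> /andP[q0 q1] cM z1.
have Mq0 : M * q ^+ k @[k --> \oo] --> (0 : R).
  rewrite -[X in _ --> X](mulr0 M); apply: cvgM; first exact: cvg_cst.
  by apply: cvg_expr; rewrite ger0_norm// ltW.
apply: (cvg0_le_norm Mq0) => k; rewrite subr0 ger0_norm ?normc_ge0// normcM normcX.
by apply: le_trans (cM k); rewrite ler_piMr ?normc_ge0// exprn_ile1 ?normc_ge0// ltW.
Qed.

Lemma geometric_coefs_subM f b : has_geometric_coefs f ->
  has_geometric_coefs (fun z => (z - b) * f z).
Proof.
move=> [c [M [q [q01 cM cf]]]]; have /andP[q0 _] := q01.
have M0 := geometric_bound_ge0 cM.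
pose shift k := if k is k'.+1 then c k' else 0.
have shiftM k : normc (shift k) <= (M / q) * q ^+ k.
  case: k => [|k]; first by rewrite normc0 expr0 mulr1 divr_ge0// ltW.
  by rewrite /= exprS mulrA divfK ?gt_eqF.
exists (fun k => shift k - b * c k), (M / q + normc b * M), q; split => //.
  move=> k; apply: (le_trans (le_normcB _ _)); rewrite mulrDl lerD// normcM -mulrA.
  by rewrite ler_wpM2l ?normc_ge0.
move=> z z1.
have partial N : \sum_(k < N) (shift k - b * c k) * z ^+ k =
    (z - b) * (\sum_(k < N) c k * z ^+ k) - shift N * z ^+ N.
  elim: N => [|N IH]; first by rewrite !big_ord0 mulr0 mul0r subr0.
  by rewrite !big_ord_recr/= IH exprS; ring.
apply: (eq_ctends partial); rewrite -[X in ctends _ _ X]subr0; apply: ctendsB.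
  by apply: ctendsMl; exact: cf.
exact: ctends_geometric_term shiftM z1.
Qed.

(* If the [c k] are the coefficients of f, the [c k + div_coefs b c k] are those of
   [f z / (1 - b * z)]. *)
Fixpoint div_coefs b c k : R[i] :=
  if k is k'.+1 then b * (c k' + div_coefs b c k') else 0.

Lemma div_coefs_le b c M r k : normc b < r -> (forall k, normc (c k) <= M * r ^+ k) ->
  normc (div_coefs b c k) <= normc b * M / (r - normc b) * r ^+ k.
Proof.
move=> br cM; have rb : 0 < r - normc b by rewrite subr_gt0.
have M0 := geometric_bound_ge0 cM.
set L := _ / _; have rL : normc b * (M + L) = r * L by rewrite /L; field; rewrite gt_eqF.
elim: k => [|k IH]; first by rewrite normc0 mulr_ge0// divr_ge0 ?mulr_ge0 ?normc_ge0// ltW.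
rewrite /= normcM exprS (mulrCA L) mulrA -rL -mulrA ler_wpM2l ?normc_ge0//.
by rewrite mulrDl (le_trans (le_normcD _ _))// lerD.
Qed.

Lemma sum_div_coefs b c z N : (1 - b * z) * (\sum_(k < N) (c k + div_coefs b c k) * z ^+ k) =
  \sum_(k < N) c k * z ^+ k - div_coefs b c N * z ^+ N.
Proof.
elim: N => [|N IH]; first by rewrite !big_ord0 mulr0 mul0r subr0.
by rewrite !big_ord_recr/= mulrDr IH exprS; ring.
Qed.

Lemma geometric_coefs_div_sub1 f b : normc b < 1 -> has_geometric_coefs f ->
  has_geometric_coefs (fun z => f z / (1 - b * z)).
Proof.
move=> b1 [c [M [q [/andP[q0 q1] cM cf]]]]; have M0 := geometric_bound_ge0 cM.
pose r := Num.max q ((1 + normc b) / 2).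
have r01 : 0 < r < 1 by rewrite /r lt_max gt_max q0 q1/=; lra.
have br : normc b < r by rewrite /r lt_max; apply/orP; right; lra.
have {}cM k : normc (c k) <= M * r ^+ k.
  apply: (le_trans (cM k)); rewrite ler_wpM2l// lerXn2r ?nnegrE ?(ltW q0)//.
    by case/andP: r01 => /ltW.
  by rewrite /r le_max lexx.
have dM k := div_coefs_le k br cM.
exists (fun k => c k + div_coefs b c k), (M + normc b * M / (r - normc b)), r; split => //.
  by move=> k; apply: (le_trans (le_normcD _ _)); rewrite mulrDl lerD.
move=> z z1; have d0 : 1 - b * z != 0 by rewrite sub1_neq0// normcM_lt1// ltW.
rewrite -[f z]subr0; apply: (@eq_ctends _ _ _ _ (fun N => (\sum_(k < N) c k * z ^+ k -
    div_coefs b c N * z ^+ N) / (1 - b * z))) => [N|].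
  by rewrite -sum_div_coefs mulrC mulKf.
apply: ctendsM (ctends_cst _); apply: ctendsB; first exact: cf.
exact: ctends_geometric_term r01 dM z1.
Qed.

Lemma geometric_coefs_div_sub1X f b n : normc b < 1 -> has_geometric_coefs f ->
  has_geometric_coefs (fun z => f z / (1 - b * z) ^+ n).
Proof.
move=> b1 gf; elim: n => [|n IH]; first by under eq_fun do rewrite expr0 divr1.
by under eq_fun do rewrite exprSr invfM mulrA; exact: geometric_coefs_div_sub1.
Qed.

Lemma geometric_coefs_mobius_prod f (zs : seq R[i]) : all_disc zs -> has_geometric_coefs f ->
  has_geometric_coefs (fun z => mobius_prod zs z * f z).
Proof.
move=> + gf; elim: zs => [|b zs IH].
  by move=> _; under eq_fun do rewrite mobius_prod_nil mul1r.
move=> /andP[b1 /IH gzs].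
under eq_fun do rewrite mobius_prod_cons /mobius -mulrA mulrAC mulrA.
apply: geometric_coefs_div_sub1; first by rewrite normc_conj.
by under eq_fun do rewrite -mulrA; exact: geometric_coefs_subM.
Qed.

End GeometricCoefficients.

Section HardyNorm.
Variable R : realType.
Local Notation lam := (@lebesgue_measure R).
Implicit Types (f : R[i] -> R[i]) (a z : R[i]).

Lemma circle_mean_cst (x : R) : (2 * pi)^-1 * \int[lam]_(t in I02pi) cst x t = x.
Proof.
by rewrite Rintegral_cst//= lebesgue_I02pi/= mulrCA mulVf ?mulr1// gt_eqF// twopi_gt0.
Qed.

Lemma le_circle_mean (g h : R -> R) : continuous g -> continuous h ->
  (forall t, g t <= h t) ->
  (2 * pi)^-1 * \int[lam]_(t in I02pi) g t <= (2 * pi)^-1 * \int[lam]_(t in I02pi) h t.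
Proof.
move=> cg ch gh; rewrite ler_wpM2l ?invr_ge0 ?(ltW (twopi_gt0 R))//.
by apply: le_Rintegral => //; exact: cont_integrable.
Qed.

Lemma H2_norm_gt0 f (B m r : R) :
  (forall x, 0 <= x < 1 -> ccont (fun t => f (x%:C * expi t))) ->
  (forall z, in_disc z -> normc (f z) <= B) ->
  0 <= r < 1 -> 0 < m -> (forall t, m <= normc (f (r%:C * expi t))) ->
  0 < H2_norm f.
Proof.
move=> cf fB r01 m0 fm; rewrite sqrtr_gt0; set means := (X in sup X).
have cn x : 0 <= x < 1 -> continuous (fun t => normc (f (x%:C * expi t)) ^+ 2).
  by move=> x1 t; have := ccont_normc (cf x x1) (x := t) => cfx; exact: (cvgM cfx cfx).
have c_cst (x : R) : continuous (cst x : R -> R) by move=> t; exact: cvg_cst.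
have means_ub : ubound means (B ^+ 2).
  move=> _ [x /= x1 <-]; move: x1; rewrite in_itv/= => x1.
  rewrite -[leRHS]circle_mean_cst; apply: le_circle_mean; [exact: cn|exact: c_cst|].
  move=> t; have fxB := fB _ (in_disc_polar t x1).
  by rewrite /cst lerXn2r ?nnegrE ?normc_ge0// (le_trans (normc_ge0 _) fxB).
have means_r : means ((2 * pi)^-1 *
    \int[lam]_(t in I02pi) (normc (f (r%:C * expi t)) ^+ 2)).
  by exists r => //=; rewrite in_itv.
apply: lt_le_trans (ub_le_sup (ex_intro _ _ means_ub) means_r).
apply: (@lt_le_trans _ _ (m ^+ 2)); first exact: exprn_gt0.
rewrite -[leLHS]circle_mean_cst; apply: le_circle_mean; [exact: c_cst|exact: cn|].
by move=> t; rewrite /cst lerXn2r ?nnegrE ?normc_ge0 ?(ltW m0).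
Qed.

Lemma normc_szego_kernel n a z : normc (szego_kernel n a z) =
  n`!%:R * normc z ^+ n / normc (1 - a^* * z) ^+ n.+1.
Proof.
rewrite /szego_kernel !normcM normcV !normcX; congr (_ * _ / _).
by rewrite -(rmorph_nat (real_complex R)) normcR ger0_norm.
Qed.

Lemma szego_kernel_le n a z : in_disc a -> in_disc z ->
  normc (szego_kernel n a z) <= n`!%:R / (1 - normc a) ^+ n.+1.
Proof.
move=> a1 z1; have a1' : 0 < 1 - normc a by rewrite subr_gt0.
rewrite normc_szego_kernel ler_pM ?mulr_ge0 ?invr_ge0 ?exprn_ge0 ?normc_ge0//.
  by rewrite ler_piMr// exprn_ile1 ?normc_ge0// ltW.
have ge := normc_1sub_ge a^* (ltW z1); rewrite normc_conj in ge.
rewrite lef_pV2 ?posrE ?exprn_gt0 ?(lt_le_trans a1')//.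
by rewrite lerXn2r ?nnegrE ?normc_ge0// ltW.
Qed.

Lemma szego_kernel_ge n a z : in_disc a -> normc z = 2^-1 ->
  n`!%:R * 2^-1 ^+ n / 2 ^+ n.+1 <= normc (szego_kernel n a z).
Proof.
move=> a1 zE; have z1 : normc z <= 1 by rewrite zE; lra.
rewrite normc_szego_kernel zE ler_wpM2l ?mulr_ge0 ?exprn_ge0//.
rewrite lef_pV2 ?posrE ?exprn_gt0//; last by rewrite normc_gt0 mobius_den_neq0.
by rewrite lerXn2r ?nnegrE ?normc_ge0// normc_1sub_le ?normc_conj// ltW.
Qed.

Lemma szego_H2_norm_gt0 n a : in_disc a -> 0 < H2_norm (szego_kernel n a).
Proof.
move=> a1; apply: (@H2_norm_gt0 _ (n`!%:R / (1 - normc a) ^+ n.+1)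
  (n`!%:R * 2^-1 ^+ n / 2 ^+ n.+1) 2^-1).
- move=> x x01; have cz : ccont (fun t => x%:C * expi t) by exact/ccontMl/ccont_expi.
  apply: ccontM; first exact/ccontMl/ccontX.
  apply: ccontV => [t|]; last exact/ccontX/ccontB/ccontMl/cz/ccont_cst.
  by rewrite expf_neq0// mobius_den_neq0// ltW//; exact: in_disc_polar.
- by move=> z; exact: szego_kernel_le.
- by apply/andP; split; lra.
- by rewrite divr_gt0 ?mulr_gt0 ?exprn_gt0// ltr0n fact_gt0.
- by move=> t; apply: szego_kernel_ge => //; rewrite normcM_expi normcR ger0_norm.
Qed.

End HardyNorm.

(** * The Blaschke factor of a factorization *)

Section BoundedAboveBelow.
Variable R : realType.
Local Notation T := (measurableTypeR R).
Implicit Types (f g : R[i] -> R[i]) (nu : {measure set T -> \bar R}) (r : R).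

Definition bounded_above_below g := forall r, r < 1 ->
  exists2 M, 0 < M & forall z, normc z <= r -> M^-1 <= normc (g z) <= M.

Lemma eq_bounded_above_below f g : (forall z, in_disc z -> f z = g z) ->
  bounded_above_below g -> bounded_above_below f.
Proof.
move=> fg bg r r1; have [M M0 gM] := bg r r1; exists M => // z zr.
by rewrite fg ?gM// /in_disc (le_lt_trans zr).
Qed.

Lemma bounded_above_below_unimodular (c : R[i]) : normc c = 1 ->
  bounded_above_below (fun=> c).
Proof. by move=> c1 r _; exists 1 => // z _; rewrite c1 invr1 lexx. Qed.

Lemma bounded_above_belowM f g : bounded_above_below f -> bounded_above_below g ->
  bounded_above_below (fun z => f z * g z).
Proof.
move=> bf bg r r1; have [M M0 fM] := bf r r1; have [N N0 gN] := bg r r1.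
exists (M * N); first exact: mulr_gt0.
move=> z zr; have /andP[Mf fM'] := fM z zr; have /andP[Ng gN'] := gN z zr.
by rewrite normcM invfM !ler_pM ?invr_ge0 ?normc_ge0// ltW.
Qed.

Lemma bounded_above_below_cexp_herglotz nu (k : R -> R) (x : R) :
  nu.-integrable J02pi (EFin \o k) ->
  bounded_above_below (fun z => cexp (x%:C * herglotz nu k z)).
Proof.
move=> ik r r1; pose L := `|x| * (2 / (1 - r) * \int[nu]_(t in J02pi) `|k t|).
exists (expR L); first exact: expR_gt0.
move=> z zr; have z1 : in_disc z by rewrite /in_disc (le_lt_trans zr).
rewrite normc_cexp -expRN !ler_expR -ler_norml ReZ normrM ler_wpM2l//.
apply: (le_trans (Re_herglotz_bound z1 ik)); rewrite ler_wpM2r//.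
  by apply: Rintegral_ge0 => t _.
by rewrite ler_wpM2l// lef_pV2 ?posrE ?subr_gt0// lerD2l lerN2.
Qed.

Lemma bounded_above_below_outer o : is_outer o -> bounded_above_below o.
Proof.
move=> [c [k [c1 [ik oE]]]]; apply: eq_bounded_above_below oE _.
apply: bounded_above_belowM; first exact: bounded_above_below_unimodular.
exact/bounded_above_below_cexp_herglotz/integrable_I02pi_J02pi.
Qed.

Lemma integrable_cst1 nu : (nu J02pi < +oo)%E -> nu.-integrable J02pi (EFin \o (fun=> 1 : R)).
Proof.
move=> nufin; apply: measurable_bounded_integrable => //.
exists 1; split; first exact: num_real.
by move=> x x1 t _ /=; rewrite normr1 ltW.
Qed.

Lemma bounded_above_below_singular_inner s : is_singular_inner s -> bounded_above_below s.
Proof.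
move=> [c [nu [c1 [_ [nufin [_ sE]]]]]].
apply: (@eq_bounded_above_below _ (fun z => c * cexp ((- 1)%:C * herglotz nu (fun=> 1) z))).
  by move=> z /sE ->; rewrite rmorphN1 mulN1r.
apply: bounded_above_belowM; first exact: bounded_above_below_unimodular.
exact/bounded_above_below_cexp_herglotz/integrable_cst1.
Qed.

End BoundedAboveBelow.

Section ZeroUniqueness.
Variable R : realType.
Implicit Types (z w : R[i]) (zs ws : seq R[i]) (phi g h : R[i] -> R[i]) (r M : R).

Definition dominated zs ws := forall r, r < 1 -> exists M, forall z,
  normc z <= r -> normc (mobius_prod zs z) <= M * normc (mobius_prod ws z).

Lemma dominated_perm zs zs' ws : perm_eq zs zs' -> dominated zs ws -> dominated zs' ws.
Proof.
by move=> p dom r /dom[M MP]; exists M => z /MP; rewrite (mobius_prod_perm _ p).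
Qed.

Lemma dominated_of_eq zs ws g h : bounded_above_below g -> bounded_above_below h ->
  (forall z, in_disc z -> mobius_prod zs z * g z = mobius_prod ws z * h z) ->
  dominated zs ws.
Proof.
move=> bg bh gh r r1; have [M M0 gM] := bg r r1; have [N _ hN] := bh r r1.
exists (N * M) => z zr; have /andP[Mg _] := gM z zr; have /andP[_ hN'] := hN z zr.
have /(congr1 (fun w => normc w)) : mobius_prod zs z * g z = mobius_prod ws z * h z.
  by rewrite gh// /in_disc (le_lt_trans zr).
rewrite !normcM => ghz; rewrite -(ler_pM2r (x := M^-1)) ?invr_gt0//.
rewrite mulrAC mulfK ?gt_eqF// mulrC [leRHS]mulrC.
apply: le_trans (_ : normc (mobius_prod zs z) * normc (g z) <= _).
  by rewrite mulrC ler_wpM2l ?normc_ge0.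
by rewrite ghz ler_wpM2l ?normc_ge0.
Qed.

Lemma le_mobius_prod_closure zs ws w M : all_disc zs -> all_disc ws -> in_disc w ->
  (\forall x \near (0 : R)^'+, normc (mobius_prod zs (w + x%:C)) <=
                               M * normc (mobius_prod ws (w + x%:C))) ->
  normc (mobius_prod zs w) <= M * normc (mobius_prod ws w).
Proof.
move=> hz hw w1; have tends_w : ctends (0 : R)^'+ (fun x : R => w + x%:C) w.
  rewrite -[X in ctends _ _ X]addr0; apply: ctendsD; first exact: ctends_cst.
  by apply: ctends_real; apply: cvg_at_right_filter; exact: cvg_id.
apply: ler_cvg_to.
  by apply: ctends_normc; apply: ctends_mobius_prod => //; exact: ltW.
apply: cvgM (cvg_cst _) _.
by apply: ctends_normc; apply: ctends_mobius_prod => //; exact: ltW.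
Qed.

Lemma dominated_cons zs ws w : all_disc (w :: zs) -> all_disc ws ->
  dominated (w :: zs) (w :: ws) -> dominated zs ws.
Proof.
move=> /andP[w1 hz] hw dom r r1.
pose r' := Num.max r ((1 + normc w) / 2).
have r'1 : r' < 1 by rewrite gt_max r1; lra.
have wr' : normc w < r' by rewrite lt_max; apply/orP; right; lra.
have [M MP] := dom r' r'1; exists M.
have off z : normc z <= r' -> z != w ->
    normc (mobius_prod zs z) <= M * normc (mobius_prod ws z).
  move=> zr zw; have := MP z zr.
  rewrite !mobius_prod_cons ![normc (mobius w z * _)]normcM mulrCA ler_pM2l//.
  by rewrite normc_gt0 mobius_eq0// (le_trans zr)// ltW.
move=> z zr; have zr' : normc z <= r' by rewrite (le_trans zr)// le_max lexx.
have [->|zw] := eqVneq z w; last exact: off.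
apply: le_mobius_prod_closure => //; near=> x.
have x0 : 0 < x by near: x; exact: nbhs_right_gt.
have xr : x < r' - normc w by near: x; apply: nbhs_right_lt; rewrite subr_gt0.
apply: off; last by rewrite -subr_eq0 addrAC subrr add0r fmorph_eq0 gt_eqF.
by apply: (le_trans (le_normcD _ _)); rewrite normcR gtr0_norm//; lra.
Unshelve. all: by end_near. Qed.

Lemma dominated_perm_cat zs ws : all_disc zs -> all_disc ws -> dominated zs ws ->
  exists rest, perm_eq zs (ws ++ rest).
Proof.
elim: ws zs => [|w ws IH] zs hz hw dom; first by exists zs.
have /andP[w1 hw'] := hw.
have wz : w \in zs.
  rewrite -(mobius_prod_eq0 hz (ltW w1)) -normc_eq0 eq_le normc_ge0 andbT.
  have [M /(_ w (lexx _))] := dom _ w1.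
  have /eqP -> : mobius_prod (w :: ws) w == 0 by rewrite mobius_prod_eq0 ?mem_head// ltW.
  by rewrite normc0 mulr0.
have p := perm_to_rem wz.
have hz' : all_disc (w :: rem w zs) by rewrite /all_disc -(perm_all _ p).
have [rest pr] : exists rest, perm_eq (rem w zs) (ws ++ rest).
  apply: IH => //; first by case/andP: hz'.
  by apply: dominated_cons hz' hw' _; exact: dominated_perm p dom.
by exists rest; apply: (perm_trans p); rewrite /= perm_cons.
Qed.

Lemma mobius_prod_zeros_unique zs ws g h : all_disc zs -> all_disc ws ->
  bounded_above_below g -> bounded_above_below h ->
  (forall z, in_disc z -> mobius_prod zs z * g z = mobius_prod ws z * h z) ->
  perm_eq zs ws.
Proof.
move=> hz hw bg bh gh.
have [rz pz] := dominated_perm_cat hz hw (dominated_of_eq bg bh gh).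
have [rw pw] : exists rest, perm_eq ws (zs ++ rest).
  by apply: dominated_perm_cat => //; apply: dominated_of_eq bh bg _ => z /gh.
suff /size0nil rz0 : size rz = 0%N by rewrite rz0 cats0 in pz.
apply/eqP; have := perm_size pw; rewrite size_cat (perm_size pz) size_cat -addnA => /eqP.
by rewrite -[X in X == _]addn0 eqn_add2l eq_sym addn_eq0 => /andP[].
Qed.

Lemma all_disc_gap zs : all_disc zs ->
  exists2 d : R, 0 < d & forall w, w \in zs -> d <= 1 - normc w.
Proof.
elim: zs => [|w zs IH]; first by exists 1.
move=> /andP[w1 /IH[d d0 dz]]; exists (Num.min d (1 - normc w)).
  by rewrite lt_min d0 subr_gt0.
by move=> v; rewrite inE => /predU1P[->|/dz vd]; rewrite ge_min ?lexx ?orbT// vd.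
Qed.

Lemma blaschke_zero (a : nat -> option R[i]) (c : R[i]) m phi k w :
  (forall z, in_disc z -> ccvg (fun N => c * z ^+ m * \prod_(k < N)
     match a k with Some w => blaschke_factor w z | None => 1 end) (phi z)) ->
  in_disc w -> a k = Some w -> phi w = 0.
Proof.
move=> phiE w1 akw; apply: (ctends_unique (phiE w w1)).
apply: ctends_near_cst; exists k.+1 => // n kn; rewrite (bigD1 (Ordinal kn))//= akw.
by rewrite /blaschke_factor subrr mul0r mulr0 mul0r mulr0.
Qed.

(* A zero repeated infinitely often would contradict the Blaschke condition. *)
Lemma blaschke_finite phi zs : is_Blaschke phi -> all_disc zs ->
  (forall z, in_disc z -> phi z = 0 -> z \in zs) ->
  exists (c : R[i]) ws, [/\ normc c = 1, all_disc ws &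
    forall z, in_disc z -> phi z = c * mobius_prod ws z].
Proof.
move=> [c [m [a [c1 [aP [asum phiE]]]]]] hz phi0.
have [d d0 dz] := all_disc_gap hz.
have := cvg_series_cvg_0 asum => /cvgrPdist_lt/(_ _ d0)[K _ aK].
have aN k : (K <= k)%N -> a k = None.
  move=> Kk; case E : (a k) => [w|//]; have [_ w1] := aP _ _ E.
  have dw := dz _ (phi0 _ w1 (blaschke_zero phiE w1 E)).
  have := aK k Kk; rewrite /= E sub0r normrN.
  by rewrite ger0_norm ?(le_trans (ltW d0))// ltNge dw.
pose ws := pmap a (iota 0 K).
have wsP w : w \in ws -> w != 0 /\ in_disc w.
  by rewrite mem_pmap => /mapP[k _ /esym]; exact: aP.
have ws0 : 0 \notin ws by apply/negP => /wsP[]; rewrite eqxx.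
have [e e1 eE] := mobius_prod_blaschke_factors m ws0.
have e0 : e != 0 by rewrite -normc_gt0 e1.
exists (c / e), (nseq m 0 ++ ws); split.
- by rewrite normcM normcV c1 e1 divr1.
- rewrite /all_disc all_cat all_nseq normc0 ltr01 orbT /=.
  by apply/allP => w /wsP[].
- move=> z z1; apply: (ctends_unique (phiE z z1)).
  by rewrite eE !mulrA divfK//; exact: ctends_blaschke_eventually_None.
Qed.

Lemma blaschke_part_unique f phi s o g zs : all_disc zs -> is_outer g ->
  (forall z, in_disc z -> f z = mobius_prod zs z * g z) ->
  inner_outer_factorization f phi s o ->
  exists2 c : R[i], normc c = 1 & forall z, in_disc z -> phi z = c * mobius_prod zs z.
Proof.
move=> hz og fE [bphi [ss [oo fact]]].
have phi0 z : in_disc z -> phi z = 0 -> z \in zs.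
  move=> z1 pz; rewrite -(mobius_prod_eq0 hz (ltW z1)).
  have := fact z z1; rewrite fE// pz !mul0r => /eqP.
  by rewrite mulf_eq0 (negbTE (is_outer_neq0 og z1)) orbF.
have [c [ws [c1 hw phiE]]] := blaschke_finite bphi hz phi0.
exists c => // z z1; rewrite phiE//; congr (_ * _); apply: mobius_prod_perm.
rewrite perm_sym.
apply: (@mobius_prod_zeros_unique _ _ g (fun z => c * (s z * o z))) => //.
- exact: bounded_above_below_outer.
- apply: bounded_above_belowM; first exact: bounded_above_below_unimodular.
  apply: bounded_above_belowM; first exact: bounded_above_below_singular_inner.
  exact: bounded_above_below_outer.
- by move=> x x1; rewrite -fE// fact// phiE//; ring.
Qed.

End ZeroUniqueness.

(** * Poisson means *)

Section Tonelli.
Local Open Scope ereal_scope.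
Context d1 d2 (T1 : measurableType d1) (T2 : measurableType d2) (R : realType).
Variables (m1 : {sigma_finite_measure set T1 -> \bar R})
          (m2 : {sigma_finite_measure set T2 -> \bar R}).
Variables (A : set T1) (B : set T2) (f : T1 * T2 -> \bar R).
Hypotheses (mA : measurable A) (mB : measurable B).
Hypotheses (mf : measurable_fun (A `*` B) f) (f0 : forall x, 0 <= f x).

Let g := f \_ (A `*` B).

Let mg : measurable_fun setT g.
Proof. exact: (measurable_restrictT f (measurableX mA mB)).1 mf. Qed.

Let g0 x : 0 <= g x. Proof. by rewrite /g patchE; case: ifPn. Qed.

Let integral2_g x : \int[m2]_y g (x, y) = ((fun x => \int[m2]_(y in B) f (x, y)) \_ A) x.
Proof.
rewrite patchE; case: ifPn => [xA|/negbTE xA].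
  rewrite [RHS]integral_mkcond; apply: eq_integral => y _.
  by rewrite /g !patchE in_setX xA.
by apply: integral0_eq => y _; rewrite /g patchE in_setX xA.
Qed.

Let integral1_g y : \int[m1]_x g (x, y) = ((fun y => \int[m1]_(x in A) f (x, y)) \_ B) y.
Proof.
rewrite patchE; case: ifPn => [yB|/negbTE yB].
  rewrite [RHS]integral_mkcond; apply: eq_integral => x _.
  by rewrite /g !patchE in_setX yB andbT.
by apply: integral0_eq => x _; rewrite /g patchE in_setX yB andbF.
Qed.

Lemma measurable_fun_integral_snd : measurable_fun A (fun x => \int[m2]_(y in B) f (x, y)).
Proof.
apply/(measurable_restrictT _ mA).
have := measurable_fun_fubini_tonelli_F (m2 := m2) _ mg g0.
by apply: eq_measurable_fun => x _; exact: integral2_g.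
Qed.

Lemma tonelli_setX : \int[m1]_(x in A) \int[m2]_(y in B) f (x, y) =
  \int[m2]_(y in B) \int[m1]_(x in A) f (x, y).
Proof.
rewrite integral_mkcond [RHS]integral_mkcond.
under eq_integral do rewrite -integral2_g.
under [RHS]eq_integral do rewrite -integral1_g.
exact: fubini_tonelli.
Qed.

End Tonelli.

Section PoissonKernel.
Variable R : realType.
Local Notation lam := (@lebesgue_measure R).
Local Notation T := (measurableTypeR R).
Implicit Types (r t x th : R) (k : R -> R).

(* This is [(1 - r^2) / |1 - r e^{ix}|^2]. *)
Definition poisson r x : R := Re ((1 + r%:C * expi (- x)) / (1 - r%:C * expi (- x))).

Lemma Re_herglotz_kernel_polar r t th :
  Re (herglotz_kernel t (r%:C * expi th)) = poisson r (t - th).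
Proof.
rewrite /poisson /herglotz_kernel opprB [th - t]addrC expiD expiN conj_expi.
have e0 := expi_neq0 t; congr Re.
have -> : expi t + r%:C * expi th = expi t * (1 + r%:C * ((expi t)^-1 * expi th)).
  by rewrite mulrDr mulr1 [in RHS]mulrCA mulVKf.
have -> : expi t - r%:C * expi th = expi t * (1 - r%:C * ((expi t)^-1 * expi th)).
  by rewrite mulrBr mulr1 [in RHS]mulrCA mulVKf.
by rewrite invfM mulrACA divff// mul1r.
Qed.

Lemma poisson_ge0 r x : 0 <= r < 1 -> 0 <= poisson r x.
Proof.
move=> r01; have := Re_herglotz_kernel_polar r x 0; rewrite subr0 => <-.
by apply: Re_herglotz_kernel_ge0; exact: in_disc_polar.
Qed.

Lemma continuous_poisson r : 0 <= r < 1 -> continuous (poisson r).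
Proof.
move=> r01; have cw : ccont (fun x : R => r%:C * expi (- x)).
  by under eq_fun do rewrite expiN; exact/ccontMl/ccontJ/ccont_expi.
apply: ccont_Re; apply: ccontM; first exact/ccontD/cw/ccont_cst.
apply: ccontV; last exact/ccontB/cw/ccont_cst.
by move=> x; apply: sub1_neq0; exact: in_disc_polar.
Qed.

Lemma continuous_poisson_subl r t : 0 <= r < 1 -> continuous (fun th => poisson r (t - th)).
Proof.
move=> r01 th; apply: (@continuous_comp _ _ _ (fun th => t - th) (poisson r)).
  by apply: cvgB; [exact: cvg_cst|exact: cvg_id].
exact: continuous_poisson.
Qed.

Lemma circle_int_herglotz_kernel_polar r t : 0 <= r < 1 ->
  circle_int (fun th => herglotz_kernel t (r%:C * expi th)) = (2 * pi)%:C.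
Proof.
move=> r01; pose b : R[i] := r%:C / expi t.
have b1 : normc b < 1.
  by rewrite normcM normcV normc_expi divr1; have := in_disc_polar 0 r01; rewrite expi0 mulr1.
have kernelE th : herglotz_kernel t (r%:C * expi th) =
    1 + 2 * b * (expi th / (1 - b * expi th)).
  have d0 : expi t - r%:C * expi th != 0 by apply: expi_sub_neq0; exact: in_disc_polar.
  have d1 : 1 - b * expi th != 0 by exact: sub1_expi_neq0.
  have bE : r%:C = b * expi t by rewrite divfK ?expi_neq0.
  rewrite /herglotz_kernel bE; field; rewrite d1/=.
  by move: d0; rewrite bE.
have [ce _] := analytic_trace_expiM (analytic_trace_outer_pole b1).
under eq_fun do rewrite kernelE.
rewrite circle_intD; [|exact: ccont_cst|exact: ccontMl].
rewrite circle_int_cst circle_intZ// circle_int_expiM ?mulr0 ?addr0 ?mulr1//.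
exact: analytic_trace_outer_pole.
Qed.

Lemma integral_poisson r t : 0 <= r < 1 ->
  (\int[lam]_(th in I02pi) (poisson r (t - th))%:E)%E = (2 * pi)%:E.
Proof.
move=> r01; rewrite -[LHS]fineK; last first.
  by apply: integrable_fin_num => //; apply/cont_integrable/continuous_poisson_subl.
congr EFin; transitivity (Re (circle_int (fun th => herglotz_kernel t (r%:C * expi th)))).
  by apply: eq_Rintegral => th _; rewrite Re_herglotz_kernel_polar.
by rewrite circle_int_herglotz_kernel_polar.
Qed.

Section mean.
Variables (nu : {sigma_finite_measure set T -> \bar R}) (k : R -> R) (r : R).
Hypotheses (r01 : 0 <= r < 1) (k0 : forall t, 0 <= k t).
Hypothesis ik : nu.-integrable J02pi (EFin \o k).

Let mI : measurable (I02pi : set T). Proof. by []. Qed.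
Let mJ : measurable (J02pi : set T). Proof. by []. Qed.
Let F (x : T * T) : \bar R := (poisson r (x.2 - x.1) * k x.2)%:E.

Let F0 p : (0 <= F p)%E. Proof. by rewrite lee_fin mulr_ge0// poisson_ge0. Qed.

Let mF : measurable_fun ((I02pi : set T) `*` (J02pi : set T)) F.
Proof.
have mk : measurable_fun (J02pi : set T) k.
  by apply/measurable_EFinP; exact: (measurable_int nu ik).
apply/measurable_EFinP; apply: measurable_funM.
  apply: measurable_funTS; apply: (measurableT_comp (f := poisson r)).
    by apply: continuous_measurable_fun; exact: continuous_poisson.
  by apply: measurable_funB; [exact: measurable_snd|exact: measurable_fst].
apply: (measurable_comp mJ) => //; last exact: measurable_funTS measurable_snd.
by move=> _ [x [_ xJ] <-].
Qed.

Let herglotzE (th : R) : (\int[nu]_(t in J02pi) F (th, t) =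
  (Re (herglotz nu k (r%:C * expi th)))%:E)%E.
Proof.
rewrite Re_herglotz /Rintegral fineK.
  by apply: eq_integral => t _; rewrite Re_herglotz_kernel_polar.
apply: integrable_fin_num => //; apply: integrable_Re_herglotz => //.
exact: in_disc_polar.
Qed.

Let integral_herglotz :
  (\int[lam]_(th in I02pi) (Re (herglotz nu k (r%:C * expi th)))%:E)%E =
  (2 * pi * \int[nu]_(t in J02pi) k t)%:E.
Proof.
transitivity (\int[lam]_(th in I02pi) \int[nu]_(t in J02pi) F (th, t))%E.
  by apply: eq_integral => th _; rewrite herglotzE.
rewrite tonelli_setX//.
transitivity (\int[nu]_(t in J02pi) ((2 * pi)%:E * (EFin \o k) t))%E.
  apply: eq_integral => t _; under eq_integral do rewrite /F/= EFinM.
  rewrite ge0_integralZr//.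
  - by rewrite integral_poisson.
  - apply: measurable_funTS; apply/measurable_EFinP; apply: continuous_measurable_fun.
    exact: continuous_poisson_subl.
  - by move=> th _; rewrite lee_fin poisson_ge0.
  - by rewrite lee_fin.
by rewrite integralZl// [RHS]EFinM /Rintegral fineK//; exact: integrable_fin_num.
Qed.

Lemma herglotz_mean :
  lam.-integrable I02pi (EFin \o (fun th => Re (herglotz nu k (r%:C * expi th)))) /\
  \int[lam]_(th in I02pi) Re (herglotz nu k (r%:C * expi th)) =
    2 * pi * \int[nu]_(t in J02pi) k t.
Proof.
split; last by rewrite /Rintegral integral_herglotz.
pose u th := Re (herglotz nu k (r%:C * expi th)).
have u0 th : 0 <= u th by apply: Re_herglotz_ge0 => //; exact: in_disc_polar.
apply/integrableP; split.
  have := measurable_fun_integral_snd nu mI mJ mF F0.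
  by apply: eq_measurable_fun => th _; rewrite herglotzE.
rewrite -/u; under eq_integral => th _ do rewrite /= ger0_norm//.
by rewrite integral_herglotz ltry.
Qed.

End mean.

End PoissonKernel.

(* [herglotz_mean] needs a sigma-finite structure, which a measure of finite mass only
   acquires through an alias. *)
Section FiniteMeasure.
Variable R : realType.
Local Notation lam := (@lebesgue_measure R).
Local Notation T := (measurableTypeR R).
Variable nu : {measure set T -> \bar R}.
Hypothesis nufin : (nu setT < +oo)%E.

Let nu_fin_num : fin_num_fun nu. Proof. exact: lty_fin_num_fun. Qed.
Let nuf : set T -> \bar R := nu.
HB.instance Definition _ := Measure.on nuf.
HB.instance Definition _ := Measure_isFinite.Build _ _ _ nuf nu_fin_num.

Lemma herglotz_mean_finite (k : R -> R) (r : R) : 0 <= r < 1 -> (forall t, 0 <= k t) ->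
  nu.-integrable J02pi (EFin \o k) ->
  lam.-integrable I02pi
    (EFin \o (fun th => Re (herglotz nu k (r%:C * expi th)))) /\
  \int[lam]_(th in I02pi) Re (herglotz nu k (r%:C * expi th)) =
    2 * pi * \int[nu]_(t in J02pi) k t.
Proof. exact: (@herglotz_mean _ nuf). Qed.

End FiniteMeasure.

(** * Triviality of the singular part *)

Section UniformIntegrability.
Context d (T : measurableType d) (R : realType) (mu : {measure set T -> \bar R}).
Variable D : set T.
Hypothesis mD : measurable D.

Lemma integrable_min (f : T -> R) (M : R) : (forall x, 0 <= f x) -> 0 <= M ->
  mu.-integrable D (EFin \o f) -> mu.-integrable D (EFin \o (fun x => Num.min (f x) M)).
Proof.
move=> f0 M0 intf; have mf : measurable_fun D f.
  by apply/measurable_EFinP; exact: (measurable_int mu intf).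
apply: le_integrable intf => //.
  by apply/measurable_EFinP; exact: measurable_minr.
by move=> x _; rewrite /= lee_fin !ger0_norm ?le_min ?f0//= ge_min lexx.
Qed.

Lemma Rintegral_le_min_add (f g : T -> R) (M : R) : (forall x, 0 <= f x) ->
  (forall x, 0 <= g x) -> 0 <= M -> mu.-integrable D (EFin \o f) ->
  mu.-integrable D (EFin \o g) -> (forall x, f x <= M + g x) ->
  \int[mu]_(x in D) f x <= \int[mu]_(x in D) Num.min (f x) M + \int[mu]_(x in D) g x.
Proof.
move=> f0 g0 M0 intf ig fMg; have imin := integrable_min f0 M0 intf.
rewrite -RintegralD//; apply: le_Rintegral => //; first exact: (integrableD mD imin ig).
by move=> x _; have [fM|fM] := leP (f x) M; [rewrite lerDl|exact: fMg].
Qed.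

Variable u : nat -> T -> R.
Hypothesis Dfin : (mu D < +oo)%E.
Hypotheses (iu : forall n, mu.-integrable D (EFin \o u n)) (u0 : forall n x, 0 <= u n x).
Hypothesis u_cvg0 : {ae mu, forall x, D x -> u n x @[n --> \oo] --> (0 : R)}.

Lemma Rintegral_min_cvg0 M : 0 <= M ->
  \int[mu]_(x in D) Num.min (u n x) M @[n --> \oo] --> (0 : R).
Proof.
move=> M0; have icM : mu.-integrable D (EFin \o (fun=> M)).
  apply: measurable_bounded_integrable => //.
  exists M; split; first exact: num_real.
  by move=> x Mx y _ /=; rewrite ger0_norm// ltW.
have [] := @dominated_convergence _ T R mu D mD
  (fun n x => (Num.min (u n x) M)%:E) (cst 0%E) (EFin \o (fun=> M)) _ _ _ _ _.
- by move=> n; exact: (measurable_int mu (integrable_min (u0 n) M0 (iu n))).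
- exact: measurable_cst.
- apply: filterS u_cvg0 => x ux Dx; apply: cvg_EFin; first exact: nearW.
  by apply: (cvg0_le_norm (ux Dx)) => n /=; rewrite ger0_norm ?ge_min ?lexx// le_min u0.
- exact: icM.
- apply/aeW => x n _ /=; rewrite lee_fin ger0_norm ?ge_min ?lexx ?orbT//.
  by rewrite le_min u0.
by move=> _ _; rewrite integral0 => /fine_cvgP[_]; exact.
Qed.

Lemma Rintegral_cvg0_unif_integrable :
  (forall e, 0 < e -> exists2 M, 0 <= M &
    forall n, \int[mu]_(x in D) u n x <= \int[mu]_(x in D) Num.min (u n x) M + e) ->
  \int[mu]_(x in D) u n x @[n --> \oo] --> (0 : R).
Proof.
move=> unif; apply/cvgrPdist_le => e e0; have e20 : 0 < e / 2 by rewrite divr_gt0.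
have [M M0 uM] := unif _ e20; have /cvgrPdist_le/(_ _ e20) := Rintegral_min_cvg0 M0.
apply: filterS => n; rewrite !sub0r !normrN => small.
rewrite ger0_norm; last by apply: Rintegral_ge0 => x _.
rewrite (le_trans (uM n))// [leRHS](splitr e) lerD2r.
exact: le_trans (ler_norm _) small.
Qed.

End UniformIntegrability.

Section SingularPart.
Variable R : realType.
Local Notation lam := (@lebesgue_measure R).
Local Notation T := (measurableTypeR R).
Implicit Types (nu : {measure set T -> \bar R}) (h : R -> R) (N M e r : R).

Definition excess N h (t : R) : R := Num.max (h t - N) 0.

Lemma excess_ge0 N h t : 0 <= excess N h t.
Proof. by rewrite le_max lexx orbT. Qed.

Lemma le_add_excess N h t : h t <= N + excess N h t.
Proof. by rewrite -lerBlDl le_max lexx. Qed.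

Lemma excess_le N h t : 0 <= N -> excess N h t <= `|h t|.
Proof.
move=> N0; rewrite ge_max normr_ge0 andbT (le_trans _ (ler_norm _))//.
by rewrite gerBl.
Qed.

Lemma integrable_excess N h : 0 <= N -> lam.-integrable J02pi (EFin \o h) ->
  lam.-integrable J02pi (EFin \o excess N h).
Proof.
move=> N0 ih; have mh : measurable_fun (J02pi : set T) h.
  by apply/measurable_EFinP; exact: (measurable_int lam ih).
apply: le_integrable ih => //.
  apply/measurable_EFinP; apply: measurable_maxr => //.
  exact: measurable_funB.
by move=> t _; rewrite /= lee_fin ger0_norm ?excess_ge0// excess_le.
Qed.

Lemma excess_small h e : 0 < e -> lam.-integrable J02pi (EFin \o h) ->
  exists2 N, 0 <= N & \int[lam]_(t in J02pi) excess N h t <= e.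
Proof.
move=> e0 ih; have mJ : measurable (J02pi : set T) by [].
have [] := @dominated_convergence _ T R lam J02pi mJ
  (fun n t => (excess n%:R h t)%:E) (cst 0%E) (EFin \o (fun t => `|h t|)) _ _ _ _ _.
- by move=> n; exact: (measurable_int lam (integrable_excess (ler0n _ n) ih)).
- exact: measurable_cst.
- apply/aeW => t _ /=; apply: cvg_near_cst; near=> n.
  rewrite /excess max_r// subr_le0; near: n.
  exact: nbhs_infty_ger.
- exact: integrable_norm.
- by apply/aeW => t n _ /=; rewrite lee_fin ger0_norm ?excess_ge0// excess_le.
move=> _ _; rewrite integral0 => /fine_cvgP[_ /cvgrPdist_le/(_ _ e0)[n _ /(_ n (leqnn n))]].
rewrite /= sub0r normrN => small; exists n%:R => //.
exact: le_trans (ler_norm _) small.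
Unshelve. all: by end_near. Qed.

Lemma Re_herglotz_le_excess h N z : in_disc z -> 0 <= N -> lam.-integrable J02pi (EFin \o h) ->
  Re (herglotz lam h z) <= 2 * pi * N + Re (herglotz lam (excess N h) z).
Proof.
move=> z1 N0 ih; have icN : lam.-integrable J02pi (EFin \o (fun=> N)).
  by apply/integrable_I02pi_J02pi/cont_integrable => t; exact: cvg_cst.
have ie := integrable_excess N0 ih.
have -> : 2 * pi * N = Re (herglotz lam (fun=> N) z) by rewrite herglotz_cst.
rewrite -ReD -herglotzD//; apply: le_Re_herglotz => //.
  have mJ : measurable (J02pi : set T) by [].
  exact: (integrableD mJ icN ie).
by move=> t; exact: le_add_excess.
Qed.

Lemma Rintegral_le_min_excess (u : R -> R) h N r : 0 <= r < 1 -> 0 <= N ->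
  lam.-integrable J02pi (EFin \o h) -> lam.-integrable I02pi (EFin \o u) ->
  (forall t, 0 <= u t <= Re (herglotz lam h (r%:C * expi t))) ->
  \int[lam]_(t in I02pi) u t <=
  \int[lam]_(t in I02pi) Num.min (u t) (2 * pi * N) +
  2 * pi * \int[lam]_(t in J02pi) excess N h t.
Proof.
move=> r01 N0 ih iu uh; have ie := integrable_excess N0 ih.
have [iW <-] := herglotz_mean r01 (@excess_ge0 N h) ie.
apply: Rintegral_le_min_add => //.
- by move=> t; case/andP: (uh t).
- by move=> t; apply: Re_herglotz_ge0 (excess_ge0 _ _); exact: in_disc_polar.
- by rewrite mulr_ge0// ltW// twopi_gt0.
- move=> t; have /andP[_ ut] := uh t; apply: (le_trans ut).
  by apply: Re_herglotz_le_excess => //; exact: in_disc_polar.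
Qed.

Definition radius r0 (n : nat) : R := 1 - (1 - r0) / n.+2%:R.

Lemma radius_itv r0 n : r0 < 1 -> r0 < radius r0 n < 1.
Proof.
move=> r01; rewrite /radius; apply/andP; split; last by rewrite ltrBlDr ltrDl divr_gt0// subr_gt0.
rewrite ltrBrDl -ltrBrDr ltr_pdivrMr//.
by rewrite -[ltLHS]mulr1 ltr_pM2l ?subr_gt0// ltr1n.
Qed.

Lemma cvg_radius r0 : radius r0 n @[n --> \oo] --> (1 : R).
Proof.
rewrite -[X in _ --> X]subr0; apply: cvgB; first exact: cvg_cst.
rewrite -[X in _ --> X](mulr0 (1 - r0)); apply: cvgM; first exact: cvg_cst.
rewrite (_ : (fun n => _) = (fun n => (@harmonic R (n + 1)%N))); last first.
  by apply/funext => n; rewrite /harmonic/= addn1.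
by rewrite (cvg_shiftn 1); exact: cvg_harmonic.
Qed.

(* The Poisson means of [nu] on the circles of radius r tend to 0 almost everywhere and
   are uniformly integrable, since [h] is integrable, whereas their integrals all equal
   2 pi times the mass of [nu]. *)
Lemma poisson_limit0_mass nu h r0 : (nu setT < +oo)%E -> lam.-integrable J02pi (EFin \o h) ->
  0 <= r0 < 1 ->
  (forall r t : R, r0 < r < 1 ->
    Re (herglotz nu (fun=> 1) (r%:C * expi t)) = Re (herglotz lam h (r%:C * expi t))) ->
  {ae lam, forall t : R, 0 < t < 2 * pi ->
    Re (herglotz nu (fun=> 1) (r%:C * expi t)) @[r --> 1^'-] --> (0 : R)} ->
  \int[nu]_(t in J02pi) (1 : R) = 0.
Proof.
move=> nufin ih /andP[r00 r01] eq_poisson lim0.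
have radius01 n : 0 <= radius r0 n < 1.
  by have /andP[rn ->] := radius_itv n r01; rewrite (le_trans r00)// ltW.
pose u n (t : R) : R := Re (herglotz nu (fun=> 1) ((radius r0 n)%:C * expi t)).
have ione : nu.-integrable J02pi (EFin \o (fun=> 1 : R)).
  apply: integrable_cst1; apply: le_lt_trans nufin.
  by apply: le_measure; rewrite ?inE//; exact: measurableT.
have mean_u n := herglotz_mean_finite nufin (radius01 n) (fun=> ler01) ione.
have iu n : lam.-integrable I02pi (EFin \o u n) by case: (mean_u n).
have u0 n t : 0 <= u n t by apply: Re_herglotz_ge0 => //; exact: in_disc_polar.
have Ifin : (lam I02pi < +oo)%E by rewrite lebesgue_I02pi ltry.
have : \int[lam]_(t in I02pi) u n t @[n --> \oo] --> (0 : R).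
  apply: Rintegral_cvg0_unif_integrable => //.
    apply: ae_interior; apply: filterS lim0 => t lt /lt ut.
    move/cvg_at_leftP : ut; apply; split; last exact: cvg_radius.
    by move=> n; case/andP: (radius01 n).
  move=> e e0; have e0' : 0 < e / (2 * pi) by rewrite divr_gt0// twopi_gt0.
  have [N N0 smallN] := excess_small e0' ih.
  exists (2 * pi * N); first by rewrite mulr_ge0// ltW// twopi_gt0.
  move=> n; have u_le t : 0 <= u n t <= Re (herglotz lam h ((radius r0 n)%:C * expi t)).
    by rewrite u0 /u eq_poisson ?lexx//; exact: radius_itv.
  apply: le_trans (Rintegral_le_min_excess (radius01 n) N0 ih (iu n) u_le) _.
  by rewrite lerD2l mulrC -ler_pdivlMr ?twopi_gt0.
set m := LHS; rewrite (_ : (fun n => _) = cst (2 * pi * m)); last first.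
  by apply/funext => n; case: (mean_u n).
move=> tends0; have /eqP : 2 * pi * m = 0 by exact: (cvg_unique _ (cvg_cst _) tends0).
by rewrite mulf_eq0 (gt_eqF (twopi_gt0 R)) => /eqP.
Qed.

Lemma singular_inner_cst s q r0 : is_singular_inner s -> is_outer q -> 0 <= r0 < 1 ->
  (forall z : R[i], r0 < normc z < 1 -> normc (s z) = normc (q z)) ->
  {ae lam, forall t : R, 0 < t < 2 * pi ->
    normc (s (r%:C * expi t)) @[r --> 1^'-] --> (1 : R)} ->
  exists2 c : R[i], normc c = 1 & forall z, in_disc z -> s z = c.
Proof.
move=> [c [nu [c1 [nuC [nufin [_ sE]]]]]] [d [k [d1 [ik qE]]]] r01 sq lim1.
have mJ : measurable (J02pi : set T) by [].
have nuT : (nu setT < +oo)%E.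
  rewrite -(setUv J02pi) measureU//; [|exact: measurableC|exact: setICr].
  by rewrite [X in (_ + X)%E]nuC adde0.
have {}ik := integrable_I02pi_J02pi ik.
pose h t := - (2 * pi)^-1 * k t.
have ih : lam.-integrable J02pi (EFin \o h) by exact: (integrableZl mJ _ ik).
have eq_poisson (r t : R) : r0 < r < 1 ->
    Re (herglotz nu (fun=> 1) (r%:C * expi t)) = Re (herglotz lam h (r%:C * expi t)).
  move=> /andP[r0r r1]; have r00 : 0 <= r by case/andP: r01 => /le_trans h0 _; apply/h0/ltW.
  have z1 : in_disc (r%:C * expi t) by apply: in_disc_polar; rewrite r00.
  have := sq (r%:C * expi t); rewrite normcM_expi normcR ger0_norm// r0r r1 => /(_ isT).
  rewrite sE// qE// (normcM c) (normcM d) c1 d1 !mul1r !normc_cexp => /expR_inj.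
  by rewrite herglotzZ// ReZ ReN ReZ mulNr => <-; rewrite opprK.
have lim0 : {ae lam, forall t : R, 0 < t < 2 * pi ->
    Re (herglotz nu (fun=> 1) (r%:C * expi t)) @[r --> 1^'-] --> (0 : R)}.
  apply: filterS lim1 => t lt /lt lim1.
  have : - ln (normc (s (r%:C * expi t))) @[r --> 1^'-] --> (0 : R).
    by rewrite -oppr0 -(ln1 R); apply: cvgN; exact: cvg_ln.
  apply: cvg_trans; apply: near_eq_cvg; near=> r.
  rewrite sE; last first.
    apply: in_disc_polar; apply/andP.
    by split; near: r; [exact: nbhs_left_ge|exact: nbhs_left_lt].
  by rewrite (normcM c) c1 mul1r normc_cexp expRK ReN opprK.
have /eqP := poisson_limit0_mass nuT ih r01 eq_poisson lim0.
rewrite Rintegral_cst// mul1r fine_eq0 ?ge0_fin_numE// => /eqP nu0.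
exists c => // z z1; rewrite sE// herglotz_null ?oppr0 ?cexp0 ?mulr1//.
exact: integrable_cst1.
Unshelve. all: by end_near. Qed.

End SingularPart.

(** * Mean-frequency *)

Section MeanFrequency.
Variable R : realType.
Local Notation lam := (@lebesgue_measure R).
Implicit Types (f g phi s o : R[i] -> R[i]) (z : R[i]) (zs : seq R[i]).

Lemma zero_free_annulus zs : all_disc zs ->
  exists2 r : R, 0 <= r < 1 & forall z, r < normc z -> z \notin zs.
Proof.
move=> /all_disc_gap[d d0 dz]; exists (Num.max 0 (1 - d)).
  by rewrite le_max lexx gt_max ltr01/= ltrBlDr ltrDl.
by move=> z; rewrite gt_max => /andP[_ rz]; apply/negP => /dz; lra.
Qed.

Lemma eq_radial_limit f g (t : R) w : (forall z, in_disc z -> f z = g z) ->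
  radial_limit g t w -> radial_limit f t w.
Proof.
move=> fg; apply: cvg_trans; apply: near_eq_cvg; near=> r.
rewrite fg//; apply: in_disc_polar; apply/andP.
by split; near: r; [exact: nbhs_left_ge|exact: nbhs_left_lt].
Unshelve. all: by end_near. Qed.

Lemma singular_part_unique f g zs phi s o th : all_disc zs -> is_outer g ->
  (forall z, in_disc z -> f z = mobius_prod zs z * g z) ->
  inner_outer_factorization f phi s o -> is_phase s th ->
  exists2 c : R[i], normc c = 1 & forall z, in_disc z -> s z = c.
Proof.
move=> hz og fE fact [lims _]; have [c c1 phiE] := blaschke_part_unique hz og fE fact.
have [_ [ss [oo fact_eq]]] := fact.
have [r r01 zs_annulus] := zero_free_annulus hz.
apply: (singular_inner_cst ss (is_outerM og (is_outerV oo)) r01).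
- move=> z /andP[rz z1]; have o0 : normc (o z) != 0 by rewrite normc_eq0 is_outer_neq0.
  have m0 : mobius_prod zs z != 0 by rewrite mobius_prod_eq0 ?zs_annulus// ltW.
  have /(mulfI m0)/(congr1 (fun w => normc w)) :
      mobius_prod zs z * g z = mobius_prod zs z * (c * (s z * o z)).
    by rewrite -fE// fact_eq// phiE//; ring.
  by rewrite !normcM normcV c1 mul1r => ->; rewrite mulfK.
- by apply: filterS lims => t lim /lim /ctends_normc; rewrite normc_expi.
Qed.

Lemma mf_valueE (th_phi th_s : R -> R) : mf_value th_phi th_s = (2 * pi)^-1 *
  (\int[lam]_(t in I02pi) derive1 th_phi t + \int[lam]_(t in I02pi) derive1 th_s t).
Proof. by []. Qed.

Lemma mean_frequency_unique f g zs phi s o th_phi th_s : all_disc zs -> is_outer g ->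
  (forall z, in_disc z -> f z = mobius_prod zs z * g z) ->
  inner_outer_factorization f phi s o ->
  is_phase phi th_phi -> is_phase s th_s -> mf_value th_phi th_s = (size zs)%:R.
Proof.
move=> hz og fE fact phase_phi phase_s.
have phase_int h c ws th : normc c = 1 -> all_disc ws ->
    (forall z, in_disc z -> h z = c * mobius_prod ws z) -> is_phase h th ->
    \int[lam]_(t in I02pi) derive1 th t = 2 * pi * (size ws)%:R.
  move=> /unimodular_expi[al ->] hw hE phase_h; rewrite -Rintegral_dblaschke_phase//.
  apply: (phase_integral_unique (Th := blaschke_phase al ws)) phase_h.
  - exact: continuous_dblaschke_phase.
  - by move=> t; exact: is_derive_blaschke_phase.
  - by move=> t; apply: eq_radial_limit hE _; exact: radial_limit_mobius_prod.
have [c c1 phiE] := blaschke_part_unique hz og fE fact.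
have [d d1 sE] := singular_part_unique hz og fE fact phase_s.
have {}sE z : in_disc z -> s z = d * mobius_prod [::] z.
  by move=> /sE ->; rewrite mobius_prod_nil mulr1.
have int_phi := phase_int _ _ _ _ c1 hz phiE phase_phi.
have int_s := phase_int _ _ _ _ d1 (isT : all_disc [::]) sE phase_s.
by rewrite mf_valueE int_phi int_s mulr0 addr0 mulKf// gt_eqF// twopi_gt0.
Qed.

Theorem mean_frequency_blaschke_outer f g zs : in_H2 f -> all_disc zs -> is_outer g ->
  (forall z, in_disc z -> f z = mobius_prod zs z * g z) ->
  mean_frequency_is f (size zs)%:R.
Proof.
move=> fH2 hz og fE; split; [by []|split; [|split]].
- have [r /andP[r0 r1] zs_annulus] := zero_free_annulus hz.
  have xE : normc ((r + 1) / 2)%:C = (r + 1) / 2 by rewrite normcR ger0_norm//; lra.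
  have x1 : in_disc ((r + 1) / 2)%:C by rewrite /in_disc xE; lra.
  exists ((r + 1) / 2)%:C; split; first exact: x1.
  rewrite fE//; apply: mulf_neq0; last exact: is_outer_neq0.
  by rewrite mobius_prod_eq0 ?(ltW x1)//; apply: zs_annulus; rewrite xE; lra.
- have prodE ws : (fun z => expi 0 * mobius_prod ws z) = mobius_prod ws.
    by apply/funext => z; rewrite expi0 mul1r.
  exists (mobius_prod zs), (fun=> 1), g, (blaschke_phase 0 zs), (blaschke_phase 0 [::]).
  split; [split; [|split; [|split]]|split].
  + by rewrite -prodE; apply: is_Blaschke_mobius_prod => //; exact: normc_expi.
  + by apply: is_singular_inner_cst; exact: normc1.
  + exact: og.
  + by move=> z /fE ->; rewrite mulr1.
  + by rewrite -prodE; exact: is_phase_mobius_prod.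
  + have -> : (fun=> 1) = mobius_prod [::] :> (R[i] -> R[i]).
      by apply/funext => z; rewrite mobius_prod_nil.
    by rewrite -prodE; exact: is_phase_mobius_prod.
- by move=> phi s o th_phi th_s; exact: mean_frequency_unique hz og fE.
Qed.

Lemma mean_frequency_rational (w b : R[i]) n zs : w != 0 -> in_disc b -> all_disc zs ->
  mean_frequency_is (fun z => mobius_prod zs z * (w / (1 - b * z) ^+ n)) (size zs)%:R.
Proof.
move=> w0 b1 hz; pose g z := w / (1 - b * z) ^+ n.
apply: (mean_frequency_blaschke_outer (g := g)) => //.
- apply: geometric_coefs_in_H2; apply: geometric_coefs_mobius_prod => //.
  by apply: geometric_coefs_div_sub1X => //; exact: geometric_coefs_cst.
- by apply: is_outerM; [exact: is_outer_cst|exact/is_outerV/is_outerX/is_outer_sub1].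
Qed.

Lemma mean_frequency_szego n (a w : R[i]) : w != 0 -> in_disc a ->
  mean_frequency_is (fun z => w * szego_kernel n a z) n%:R.
Proof.
move=> w0 a1.
have -> : (fun z => w * szego_kernel n a z) =
    (fun z => mobius_prod (nseq n 0) z * ((w * n`!%:R) / (1 - a^* * z) ^+ n.+1)).
  by apply/funext => z; rewrite mobius_prod_nseq0 /szego_kernel; ring.
rewrite -[n%:R](congr1 _ (size_nseq n (0 : R[i]))); apply: mean_frequency_rational.
- by rewrite mulf_neq0// pnatr_eq0 -lt0n fact_gt0.
- by rewrite /in_disc normc_conj.
- by rewrite /all_disc all_nseq normc0 ltr01 orbT.
Qed.

Lemma mean_frequency_TM n (a : nat -> R[i]) : (1 <= n)%N ->
  (forall l : nat, (1 <= l <= n)%N -> in_disc (a l)) ->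
  mean_frequency_is (TM n a) (n.-1)%:R.
Proof.
move=> n1 ha; have an1 : in_disc (a n) by apply: ha; rewrite n1 leqnn.
pose zs := [seq a l | l <- index_iota 1 n].
have <- : size zs = n.-1 by rewrite size_map size_iota subn1.
have -> : TM n a = (fun z => mobius_prod zs z *
    ((Num.sqrt (1 - normc (a n) ^+ 2))%:C / (1 - (a n)^* * z) ^+ 1)).
  by apply/funext => z; rewrite /TM /mobius_prod big_map expr1 mulrC.
apply: mean_frequency_rational.
- by rewrite fmorph_eq0 gt_eqF// sqrtr_gt0 subr_gt0 expr_lt1 ?normc_ge0.
- by rewrite /in_disc normc_conj.
- apply/allP => b /mapP[l]; rewrite mem_index_iota => /andP[l1 ln] ->.
  by apply: ha; rewrite l1 ltnW.
Qed.

End MeanFrequency.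

Theorem theorem1 (R : realType) :
  (forall (n : nat) (a : R[i]), in_disc a ->
     mean_frequency_is (szego_kernel n a) n%:R /\
     mean_frequency_is (normalized_szego_kernel n a) n%:R) /\
  (forall (n : nat) (a : nat -> R[i]), (1 <= n)%N ->
     (forall l : nat, (1 <= l <= n)%N -> in_disc (a l)) ->
     mean_frequency_is (TM n a) (n.-1)%:R).
Proof.
split; last exact: mean_frequency_TM.
move=> n a a1; split.
- have -> : szego_kernel n a = (fun z => 1 * szego_kernel n a z).
    by apply/funext => z; rewrite mul1r.
  exact: mean_frequency_szego (oner_neq0 _) a1.
- have -> : normalized_szego_kernel n a =
      (fun z => (H2_norm (szego_kernel n a))%:C^-1 * szego_kernel n a z).
    by apply/funext => z; rewrite mulrC.
  apply: mean_frequency_szego => //.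
  by rewrite invr_eq0 fmorph_eq0 gt_eqF// szego_H2_norm_gt0.
Qed.
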